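(* Let $\alpha\in(0,1)$. Assume there is $\vartheta\in\Theta$ with $\hat\vartheta_n\to\vartheta$ in probability, and that for this $\vartheta$ the following hold. (C1) There is an open convex set $U_\vartheta\subset\Theta$ with $\vartheta\in U_\vartheta$ such that for all $x\in\overline{\mathbb R}^m$ the map $G_n(x,\cdot)$ is continuously differentiable on $U_\vartheta$. Put $g_n(x,\tilde\vartheta)=\nabla_{\tilde\vartheta}G_n(x,\tilde\vartheta)\in\mathbb R^d$ (column gradient). (C2) There is $g:\overline{\mathbb R}^m\times U_\vartheta\to\mathbb R^d$ such that $g_n\to g$ uniformly on $\overline{\mathbb R}^m\times U_\vartheta$, $g$ is uniformly continuous on $\overline{\mathbb R}^m\times U_\vartheta$, and $g(\cdot,\vartheta)$ has bounded components. Moreover, assume that for every sequence $(\vartheta_n)_{n\in\mathbb N}$ in $\Theta$ with $\vartheta_n\to\vartheta$ the following two conditions hold, where $X_1^{(n)},X_2^{(n)},\dots$ are i.i.d. with distribution function $G_n(\cdot,\vartheta_n)$ and $\hat\vartheta_n^{(n)}=t_n(X_1^{(n)},\dots,X_n^{(n)})$: (C5) There are maps $\ell_n:\mathbb R^m\times U_\vartheta\to\mathbb R^d$ such that for all $\tilde\vartheta\in U_\vartheta$: $\ell_n(\cdot,\tilde\vartheta)$ is measurable, $\int\ell_n(x,\tilde\vartheta)G_n(\mathrm dx,\tilde\vartheta)$ and $\int\ell_n(x,\tilde\vartheta)\ell_n'(x,\tilde\vartheta)G_n(\mathrm dx,\tilde\vartheta)$ exist with finite components, $\int\ell_n(x,\tilde\vartheta)G_n(\mathrm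 dx,\tilde\vartheta)=0$; and $\sqrt n(\hat\vartheta_n^{(n)}-\vartheta_n)=\sqrt n\sum_{i=1}^n\alpha_{i,n}\ell_n(X_i^{(n)},\vartheta_n)+o_p(1)$. (C6) With $v_n^{()}(\tilde\vartheta)=\int\ell_n(x,\tilde\vartheta)\ell_n'(x,\tilde\vartheta)G_n(\mathrm dx,\tilde\vartheta)$ and $w_n^{()}(y,\tilde\vartheta)=\int\ell_n(x,\tilde\vartheta)\mathrm I(x\le y)G_n(\mathrm dx,\tilde\vartheta)$, there are $v^{()}(\vartheta)\in\mathbb R^{d\times d}$ and $w^{()}(\cdot,\vartheta):\overline{\mathbb R}^m\to\mathbb R^d$ with $v_n^{()}(\vartheta_n)\to v^{()}(\vartheta)$ and $w_n^{()}(x,\vartheta_n)\to w^{()}(x,\vartheta)$ for all $x\in\overline{\mathbb R}^m$; and for all $a\in\mathbb R^d$, $t>0$, $$\lim_{n\to\infty}\int\big(1+(a'\ell_n(x,\vartheta_n))^2\big)\,\mathrm I\big((\sqrt n\max_{1\le j\le n}\alpha_{j,n})^2(a'\ell_n(x,\vartheta_n))^2>t\big)G_n(\mathrm dx,\vartheta_n)=0.$$ Let $$c^{()}(x,y,\vartheta)=\kappa\big(G(\min(x,y),\vartheta)-G(x,\vartheta)G(y,\vartheta)-g'(x,\vartheta)w^{()}(y,\vartheta)-g'(y,\vartheta)w^{()}(x,\vartheta)+g'(x,\vartheta)v^{()}(\vartheta)g(y,\vartheta)\big).$$ If neither $F-G(\cdot,\vartheta)$ nor $x\mapsto c^{()}(x,x,\vartheta)$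 vanishes everywhere on $\overline{\mathbb R}^m$, then $\lim_{n\to\infty}P(\mathrm{KS}_n\ge c_{n;1-\alpha})=1$. If neither $F-G(\cdot,\vartheta)$ nor $x\mapsto c^{()}(x,x,\vartheta)$ vanishes $G(\cdot,\vartheta)$-almost everywhere, then $\lim_{n\to\infty}P(\mathrm{CvM}_n\ge d_{n;1-\alpha})=1$.
   Context: Conventions: $\overline{\mathbb R}^l=[-\infty,\infty]^l$ with its compact product topology; $\le$ and $\min$ on $\overline{\mathbb R}^l$ are componentwise; $\mathrm I(\cdot)$ is the indicator; a prime denotes transpose; vectors are columns. A distribution function defined on $\overline{\mathbb R}^l$ is $x\mapsto P(\xi\le x)$, $x\in\overline{\mathbb R}^l$, for an $\mathbb R^l$-valued random vector $\xi$; $\int h(x)K(\mathrm dx)$ is integration with respect to the probability measure with distribution function $K$. $o_p(1)$ denotes a term converging to $0$ in probability. Setting: Let $m,d\in\mathbb N$, $\emptyset\ne\Theta\subseteq\mathbb R^d$. $X_1,X_2,\dots$ are independent, not necessarily identically distributed $\mathbb R^m$-valued random vectors, $X_i$ having distribution function $F_i$ on $\overline{\mathbb R}^m$, and $F_i\to F$ uniformly on $\overline{\mathbb R}^m$ for a uniformly continuous distribution function $F$. Maps $G_n,G:\overline{\mathbb R}^m\times\Theta\to\mathbb R$ are given such that for every $\vartheta\in\Theta$, $G_n(\cdot,\vartheta)$ and $G(\cdot,\vartheta)$ are distribution functions, $G(\cdot,\vartheta)$ is uniformly continuous, and $G_n(\cdot,\vartheta)\to G(\cdot,\vartheta)$ uniformly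 on $\overline{\mathbb R}^m$. The real weights satisfy $\alpha_{i,n}\ge0$, $\sum_{i=1}^n\alpha_{i,n}=1$, $\lim_n\sqrt n\max_{1\le i\le n}\alpha_{i,n}=0$, $\lim_n n\sum_{i=1}^n\alpha_{i,n}^2=\kappa\in[1,\infty)$. Put $\hat{\mathbb F}_n(x)=\sum_{i=1}^n\alpha_{i,n}\mathrm I(X_i\le x)$. Let $t_n:(\mathbb R^m)^n\to\Theta$ be Borel measurable and $\hat\vartheta_n=t_n(X_1,\dots,X_n)$. The statistics are $$\mathrm{KS}_n=\sqrt n\sup_{x\in\overline{\mathbb R}^m}|\hat{\mathbb F}_n(x)-G_n(x,\hat\vartheta_n)|,\qquad \mathrm{CvM}_n=n\int(\hat{\mathbb F}_n(x)-G_n(x,\hat\vartheta_n))^2G_n(\mathrm dx,\hat\vartheta_n).$$ Critical values: for $\tilde\vartheta\in\Theta$ let $c_n(\tilde\vartheta)$ (resp. $d_n(\tilde\vartheta)$) be the $(1-\alpha)$-quantile of the distribution that $\mathrm{KS}_n$ (resp. $\mathrm{CvM}_n$) has when the observations are replaced by $n$ independent random vectors each with distribution function $G_n(\cdot,\tilde\vartheta)$ (also in the estimator). Then $c_{n;1-\alpha}=c_n(\hat\vartheta_n)$ and $d_{n;1-\alpha}=d_n(\hat\vartheta_n)$ (random critical values). *)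

(* Defs.v *)
(* Conventions, over an arbitrary [R : realType].
   - Observations, i.e. points of R^m, are [m.-tuple R], with the library's
     product (= Borel) sigma-algebra; a sample of size n is a point of
     [n.-tuple (m.-tuple R)].
   - Points of Rbar^m are ['cV[\bar R]_m], whose library uniform structure
     induces the compact product topology.
   - Parameters, i.e. points of R^d, are ['cV[R]_d], normed by the library's
     maximum norm.  Functions of a parameter
     are total; only their values on Theta (or on U) are ever constrained or
     used.
   - The i-th observation and weight of the literature (i = 1, ..., n) have
     index i - 1 here. *)
From HB Require Import structures.
From mathcomp Require Import all_boot all_order all_algebra.
From mathcomp Require Import all_classical all_reals all_analysis.

Set Implicit Arguments.
Unset Strict Implicit.
Unset Printing Implicit Defensive.

Import Order.TTheory GRing.Theory Num.Theory.
Import numFieldNormedType.Exports.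

Local Open Scope classical_set_scope.
Local Open Scope ring_scope.

Section extended_space.
Context {R : realType} {m : nat}.

Definition emb (z : m.-tuple R) : 'cV[\bar R]_m := \col_k (tnth z k)%:E.

Definition lev (x y : 'cV[\bar R]_m) : bool :=
  [forall k, (x k ord0 <= y k ord0)%E].

Definition minv (x y : 'cV[\bar R]_m) : 'cV[\bar R]_m :=
  \col_k Order.min (x k ord0) (y k ord0).

End extended_space.

Section distribution_functions.
Context {R : realType} {m : nat}.

Definition dfun (mu : probability (m.-tuple R) R) (x : 'cV[\bar R]_m) : R :=
  fine (mu [set z | lev (emb z) x]).

Definition is_dfun (K : 'cV[\bar R]_m -> R) : Prop :=
  exists mu : probability (m.-tuple R) R, dfun mu = K.

(* The probability measure with distribution function K, so that the integral
   of h with respect to K(dx) is [\int[dlaw K]_x h x]; a junk value if K is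
   not a distribution function. *)
Definition dlaw (K : 'cV[\bar R]_m -> R) : probability (m.-tuple R) R :=
  get [set mu : probability (m.-tuple R) R | dfun mu = K].

Lemma dlawK (K : 'cV[\bar R]_m -> R) : is_dfun K -> dfun (dlaw K) = K.
Proof. by move=> K_df; exact: (getPex K_df). Qed.

End distribution_functions.

Section probability_notions.
Context {R : realType}.

(* Inner probability.  It makes P(A) meaningful without assuming that suprema
   over Rbar^m, critical values as functions of the parameter, etc. are measurable;
   it is P(A) as soon as A is an event (inner_probE). *)
Definition inner_prob {d} {T : measurableType d} (P : probability T R)
    (A : set T) : \bar R :=
  ereal_sup [set P B | B in [set B | measurable B /\ B `<=` A]].

Lemma inner_probE {d} {T : measurableType d} (P : probability T R)
    (A : set T) : measurable A -> inner_prob P A = P A.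
Proof.
move=> mA; apply/eqP; rewrite eq_le; apply/andP; split.
  apply: ge_ereal_sup => _ [B [mB BA] <-].
  by apply: le_measure; rewrite ?inE.
by apply: ereal_sup_ubound; exists A => //; split.
Qed.

(* The p-quantile inf {y | P(S <= y) >= p} of the law of S under P. *)
Definition quantile {d} {T : measurableType d} (P : probability T R) (p : R)
    (S : T -> R) : R :=
  inf [set y : R | (p%:E <= inner_prob P [set z | S z <= y]%R)%E].

Definition mutually_independent {d d'} {T : measurableType d}
    {T' : measurableType d'} (P : probability T R)
    (X : nat -> {mfun T >-> T'}) : Prop :=
  forall (J : seq nat) (B : nat -> set T'),
    uniq J -> (forall i, measurable (B i)) ->
    P [set w | forall i, i \in J -> B i (X i w)] =
      (\prod_(i <- J) P (X i @^-1` B i))%E.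

Definition consT {T : Type} n (p : T * n.-tuple T) : n.+1.-tuple T :=
  [tuple of p.1 :: p.2].

Lemma measurable_consT {d} {T : measurableType d} n :
  measurable_fun [set: T * n.-tuple T] (@consT T n).
Proof. exact: measurable_cons. Qed.

HB.instance Definition _ {d} {T : measurableType d} n :=
  isMeasurableFun.Build _ _ _ _ (@consT T n) (@measurable_consT d T n).

(* The joint law of n independent variables with law mu (see iid_lawE). *)
Fixpoint iid_law {d} {T : measurableType d} (mu : probability T R) (n : nat) :
    probability (n.-tuple T) R :=
  match n with
  | 0 => dirac [tuple]
  | n'.+1 => distribution (mu \x iid_law mu n')%E (@consT T n')
  end.

Lemma iid_lawE {d} {T : measurableType d} (mu : probability T R) (n : nat)
    (B : 'I_n -> set T) : (forall i, measurable (B i)) ->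
  iid_law mu n [set z | forall i, B i (tnth z i)] = (\prod_(i < n) mu (B i))%E.
Proof.
elim: n B => [|n IHn] B mB.
  rewrite big_ord0 /= (_ : [set _ | _] = setT) ?diracT//.
  by apply/seteqP; split=> // z _ [].
have mbox n' (C : 'I_n' -> set T) : (forall i, measurable (C i)) ->
    measurable [set z : n'.-tuple T | forall i, C i (tnth z i)].
  move=> mC; rewrite (_ : [set _ | _] =
      \bigcap_(i in [set: 'I_n']) (tnth (T := T))^~ i @^-1` C i).
    apply: fin_bigcap_measurable => // i _.
    by rewrite -[X in measurable X]setTI; exact: measurable_tnth.
  by apply/seteqP; split=> [z Cz i _|z Cz i]; [exact: Cz|exact: (Cz i)].
rewrite big_ord_recl /= /distribution /pushforward.
rewrite (_ : _ @^-1` _ = B ord0 `*`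
    [set z | forall i, B (lift ord0 i) (tnth z i)]).
  rewrite product_measure1E//; last by apply: (mbox n (fun i => B (lift ord0 i))) => i; exact: mB.
  by congr (_ * _)%E; apply: (IHn (fun i => B (lift ord0 i))) => i; exact: mB.
apply/seteqP; split=> [[x z] /= Bz|[x z] /= [Bx Bz] i].
  split=> [|i]; first by have := Bz ord0; rewrite tnth0.
  by have := Bz (lift ord0 i); rewrite tnthS.
by case: (unliftP ord0 i) => [j ->|->]; rewrite ?tnthS ?tnth0.
Qed.

End probability_notions.

Section statistics.
Context {R : realType} {m d : nat}.

Definition wedf (a : nat -> nat -> R) (n : nat) (z : n.-tuple (m.-tuple R))
    (x : 'cV[\bar R]_m) : R :=
  \sum_(i < n) a i n * (lev (emb (tnth z i)) x)%:R.

(* The default value 0 is harmless as the weights are nonnegative. *)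
Definition max_weight (a : nat -> nat -> R) (n : nat) : R :=
  \big[Num.max/0]_(i < n) a i n.

(* In [KS] and [CvM], [Gn] is the n-th model and [t] the n-th estimator; the
   data are both in the empirical distribution function and in the estimator. *)
Definition KS (a : nat -> nat -> R) (n : nat)
    (Gn : 'cV[\bar R]_m -> 'cV[R]_d -> R)
    (t : n.-tuple (m.-tuple R) -> 'cV[R]_d) (z : n.-tuple (m.-tuple R)) : R :=
  Num.sqrt n%:R *
    sup (range (fun x : 'cV[\bar R]_m => `|wedf a z x - Gn x (t z)|)).

Definition CvM (a : nat -> nat -> R) (n : nat)
    (Gn : 'cV[\bar R]_m -> 'cV[R]_d -> R)
    (t : n.-tuple (m.-tuple R) -> 'cV[R]_d) (z : n.-tuple (m.-tuple R)) : R :=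
  n%:R * \int[dlaw (Gn ^~ (t z))]_y
           ((wedf a z (emb y) - Gn (emb y) (t z)) ^+ 2).

Definition sample {T : Type} (X : nat -> T -> m.-tuple R) (n : nat) (om : T) :
    n.-tuple (m.-tuple R) := [tuple X i om | i < n].

(* c_n(u) for S = KS_n, d_n(u) for S = CvM_n *)
Definition critical_value (n : nat) (Gn : 'cV[\bar R]_m -> 'cV[R]_d -> R)
    (alpha : R) (S : n.-tuple (m.-tuple R) -> R) (u : 'cV[R]_d) : R :=
  quantile (iid_law (dlaw (Gn ^~ u)) n) (1 - alpha) S.

End statistics.

Section conditions.
Context {R : realType} {m d : nat}.

Definition grad (f : 'cV[R]_d -> R) (u : 'cV[R]_d) : 'cV[R]_d :=
  \col_k 'D_(delta_mx k ord0) f u.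

Definition cont_differentiable_on (U : set 'cV[R]_d) (f : 'cV[R]_d -> R) :
    Prop :=
  forall u, U u -> differentiable f u /\ {for u, continuous (grad f)}.

Definition unif_continuous_on {S V : uniformType} (A : set S) (f : S -> V) :
    Prop :=
  (fun p => (f p.1, f p.2)) @ within (A `*` A) entourage --> entourage.

Definition dot (p q : 'cV[R]_d) : R := (p^T *m q) ord0 ord0.

Definition C1 (Theta U : set 'cV[R]_d) (theta : 'cV[R]_d)
    (Gn : nat -> 'cV[\bar R]_m -> 'cV[R]_d -> R) : Prop :=
  [/\ open U, convex_set U, U `<=` Theta, U theta &
      forall n x, (0 < n)%N -> cont_differentiable_on U (Gn n x)].

Definition C2 (U : set 'cV[R]_d) (theta : 'cV[R]_d)
    (Gn : nat -> 'cV[\bar R]_m -> 'cV[R]_d -> R)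
    (g : 'cV[\bar R]_m -> 'cV[R]_d -> 'cV[R]_d) : Prop :=
  [/\ {uniform [set: 'cV[\bar R]_m] `*` U,
        (fun n xu => grad (Gn n xu.1) xu.2) @ \oo --> (fun xu => g xu.1 xu.2)},
      unif_continuous_on ([set: 'cV[\bar R]_m] `*` U)
        (fun xu => g xu.1 xu.2) &
      forall k, exists M : R, forall x, `|g x theta k ord0| <= M].

Definition vfun (Gn : 'cV[\bar R]_m -> 'cV[R]_d -> R)
    (l : m.-tuple R -> 'cV[R]_d -> 'cV[R]_d) (u : 'cV[R]_d) : 'M[R]_d :=
  \matrix_(j, k) \int[dlaw (Gn ^~ u)]_y (l y u j ord0 * l y u k ord0).

Definition wfun (Gn : 'cV[\bar R]_m -> 'cV[R]_d -> R)
    (l : m.-tuple R -> 'cV[R]_d -> 'cV[R]_d) (x : 'cV[\bar R]_m)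
    (u : 'cV[R]_d) : 'cV[R]_d :=
  \col_k \int[dlaw (Gn ^~ u)]_y (l y u k ord0 * (lev (emb y) x)%:R).

(* Here and in [C6], [un] is a sequence of parameters, and the i.i.d. sample
   with distribution function [Gn n ^~ (un n)] is the identity map on the
   product probability space [iid_law (dlaw (Gn n ^~ (un n))) n]. *)
Definition C5 (a : nat -> nat -> R) (U : set 'cV[R]_d)
    (Gn : nat -> 'cV[\bar R]_m -> 'cV[R]_d -> R)
    (t : forall n, n.-tuple (m.-tuple R) -> 'cV[R]_d)
    (un : nat -> 'cV[R]_d)
    (l : nat -> m.-tuple R -> 'cV[R]_d -> 'cV[R]_d) : Prop :=
  (forall n u, (0 < n)%N -> U u ->
    let mu := dlaw (Gn n ^~ u) in
    [/\ measurable_fun setT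
          ((fun y => l n y u) : _ -> g_sigma_algebraType (@open 'cV[R]_d)),
        forall k, mu.-integrable setT (fun y => (l n y u k ord0)%:E),
        forall j k,
          mu.-integrable setT (fun y => (l n y u j ord0 * l n y u k ord0)%:E) &
        forall k, \int[mu]_y (l n y u k ord0) = 0]) /\
  (forall eps : R, 0 < eps ->
    iid_law (dlaw (Gn n ^~ (un n))) n
      [set z | eps < `|Num.sqrt n%:R *: (t n z - un n) -
        Num.sqrt n%:R *: \sum_(i < n) a i n *: l n (tnth z i) (un n)|]
    @[n --> \oo] --> 0%E).

Definition C6 (a : nat -> nat -> R)
    (Gn : nat -> 'cV[\bar R]_m -> 'cV[R]_d -> R) (un : nat -> 'cV[R]_d)
    (l : nat -> m.-tuple R -> 'cV[R]_d -> 'cV[R]_d)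
    (v : 'M[R]_d) (w : 'cV[\bar R]_m -> 'cV[R]_d) : Prop :=
  [/\ vfun (Gn n) (l n) (un n) @[n --> \oo] --> v,
      forall x, wfun (Gn n) (l n) x (un n) @[n --> \oo] --> w x &
      forall (b : 'cV[R]_d) (s : R), 0 < s ->
        \int[dlaw (Gn n ^~ (un n))]_y
          ((1 + dot b (l n y (un n)) ^+ 2) *
           (s < (Num.sqrt n%:R * max_weight a n) ^+ 2 *
                dot b (l n y (un n)) ^+ 2)%R%:R)
        @[n --> \oo] --> 0].

(* The covariance function c(x, y, theta); [G], [g], [w], [v] are taken at
   theta. *)
Definition cov_limit (kappa : R) (G : 'cV[\bar R]_m -> R)
    (g w : 'cV[\bar R]_m -> 'cV[R]_d) (v : 'M[R]_d)
    (x y : 'cV[\bar R]_m) : R :=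
  kappa * (G (minv x y) - G x * G y - dot (g x) (w y) - dot (g y) (w x)
           + dot (g x) (v *m g y)).

End conditions.

(* Main.v *)
(* Lower-order information suffices for consistency.  Put s_n = sqrt n for KS_n and
   s_n = n for CvM_n.  Under i.i.d. sampling from G_n(., u_n) with u_n -> theta, the
   weighted empirical distribution function satisfies a Glivenko-Cantelli theorem
   (Chebyshev at finitely many grid points, since the sum of the squared weights tends
   to 0, then monotonicity), and C5 with v_n bounded makes the estimator consistent;
   with the Lipschitz bound from C1 and C2 this gives S_n / s_n -> 0 in probability.
   As this holds along every sequence u_n -> theta, it holds uniformly in a ball around
   theta, so that the critical values at the estimator are o(s_n).  For the actual data
   the same law of large numbers shows that S_n / s_n is bounded away from 0: for KS_n by
   looking at one point where F and G(., theta) differ, for CvM_n by looking at one cell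
   of positive G(., theta)-probability on which they differ by a fixed amount. *)
Require Import Defs.
From HB Require Import structures.
From mathcomp Require Import all_boot all_order all_algebra.
From mathcomp Require Import all_classical all_reals all_analysis.
From mathcomp Require Import measurable_realfun ring lra.

Set Implicit Arguments.
Unset Strict Implicit.
Unset Printing Implicit Defensive.

Import Order.TTheory GRing.Theory Num.Theory.
Import numFieldNormedType.Exports.

Local Open Scope classical_set_scope.
Local Open Scope ring_scope.

(** * Second moments of sums of independent observations *)

Section second_moments.
Context {R : realType}.

(** Measurability of the suprema in the statistics and of the critical values as functions of the
    sample is never established. The final estimates therefore concern one type of measurable event:
    the estimator is far from [theta], or the weighted empirical distribution function is off at one
    of finitely many points. Off such an event everything is a deterministic inequality, and inner
    probabilities are bounded below through its complement. Since the level is fixed, a bad event of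
    probability at most [alpha] already controls the (1 - alpha)-quantile. The maps [l] of C5 and C6
    depend on the parameter sequence, so nothing uniform in the parameter can be read off from them;
    only the bound on the probability of the bad event is transferred to a ball, by contradiction.
    For CvM the integrating measure also varies with n, so the lower bound needs its mass on a fixed
    cell; uniform closeness of distribution functions gives this by inclusion-exclusion. *)

Lemma measurable_lev (m : nat) (x : 'cV[\bar R]_m) :
  measurable [set z : m.-tuple R | lev (emb z) x].
Proof.
rewrite (_ : [set _ | _] = \bigcap_(i in [set: 'I_m])
    ((@tnth m R)^~ i @^-1` [set r : R | (r%:E <= x i ord0)%E])).
  apply: fin_bigcap_measurable => // i _.
  rewrite -[X in measurable X]setTI; apply: measurable_tnth => //.
  rewrite -[X in measurable X]setTI.
  by apply: emeasurable_fun_infty_c => //; exact: EFin_measurable.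
apply/seteqP; split=> z /=.
  by move=> /forallP zx i _ /=; have := zx i; rewrite mxE.
by move=> zx; apply/forallP => i; rewrite mxE; exact: zx.
Qed.

Lemma lev_indic (m : nat) (x : 'cV[\bar R]_m) (z : m.-tuple R) :
  (lev (emb z) x)%:R = \1_[set z' : m.-tuple R | lev (emb z') x] z :> R.
Proof.
rewrite indicE; congr ((nat_of_bool _)%:R).
by apply/idP/idP => [h|/set_mem//]; exact/mem_set.
Qed.

Lemma measurable_fun_lev (m : nat) (x : 'cV[\bar R]_m) :
  measurable_fun setT (fun z : m.-tuple R => (lev (emb z) x)%:R : R).
Proof.
rewrite (funext (lev_indic x)).
by apply: measurable_indic; exact: measurable_lev.
Qed.

Lemma measurable_abs_gt {d} {T : measurableType d} (f : T -> R) (eps : R) :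
  measurable_fun setT f -> measurable [set x | eps < `|f x|].
Proof.
move=> mf; rewrite -[X in measurable X]setTI.
exact: (@measurable_fun_ltr _ _ _ _ (cst eps) (fun x => `|f x|) _
  (measurableT_comp (@normr_measurable R setT) mf) measurableT [set true]).
Qed.

Lemma sqr_markov {d} {T : measurableType d} (P : probability T R)
    (f : T -> R) (eps : R) : 0 < eps -> measurable_fun setT f ->
  (P [set x | (eps < `|f x|)%R] <= (eps ^- 2)%:E * \int[P]_x (f x ^+ 2)%:E)%E.
Proof.
move=> eps0 mf.
have mA : measurable [set x | eps < `|f x|] by exact: measurable_abs_gt.
rewrite -lee_pdivrMl ?invr_gt0 ?exprn_gt0// invrK.
rewrite -[X in P X]setIT -integral_indic// -ge0_integralZl//; last 2 first.
- by apply/measurable_EFinP; exact: measurable_indic.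
- by rewrite lee_fin sqr_ge0.
apply: ge0_le_integral => //.
- by move=> x _; rewrite -EFinM lee_fin mulr_ge0// sqr_ge0.
- by apply/measurable_EFinP; apply: measurable_funM => //; exact: measurable_indic.
- by apply/measurable_EFinP; exact: measurable_funX.
move=> x _; rewrite -EFinM lee_fin indicE.
have [/set_mem/= lt|] := boolP (_ \in _); last by rewrite mulr0 sqr_ge0.
by rewrite mulr1 -[leRHS]real_normK ?num_real// lerXn2r ?nnegrE// ltW.
Qed.

(** The integral of a nonnegative function is a supremum over simple functions below it, so
    monotonicity needs no measurability. This spares a proof that [y] is mapped measurably to the
    model at [emb y] in the CvM integrand. *)
Lemma ge0_le_integralT {d} {T : measurableType d} (mu : probability T R)
    (f h : T -> \bar R) : (forall x, 0 <= f x)%E -> (forall x, f x <= h x)%E ->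
  (\int[mu]_x f x <= \int[mu]_x h x)%E.
Proof.
move=> f0 fh; rewrite !ge0_integralTE//; last first.
  by move=> x; exact: le_trans (f0 x) (fh x).
apply: le_ereal_sup => _ [k kf <-]; exists k => // x.
exact: le_trans (kf x) (fh x).
Qed.

Lemma bounded_integrable {d} {T : measurableType d} (P : probability T R)
    (f : T -> R) : measurable_fun setT f -> (exists M, forall x, `|f x| <= M) ->
  P.-integrable setT (EFin \o f).
Proof.
move=> mf [M fM]; apply: (@le_integrable _ _ _ _ _ measurableT _ (cst M%:E)).
- exact/measurable_EFinP.
- by move=> x _; rewrite /= lee_fin (le_trans (fM x))// ler_norm.
- exact: finite_measure_integrable_cst.
Qed.

Lemma integral_affine_sqr {d} {T : measurableType d} (mu : probability T R)
    (f : T -> R) (s c e : R) :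
  mu.-integrable setT (EFin \o f) ->
  mu.-integrable setT (fun x => ((f x) ^+ 2)%:E) ->
  (\int[mu]_x (f x)%:E = 0)%E -> (\int[mu]_x ((f x) ^+ 2)%:E = s%:E)%E ->
  (\int[mu]_x ((c * f x + e) ^+ 2)%:E = (c ^+ 2 * s + e ^+ 2)%:E)%E.
Proof.
move=> intf intf2 f0 f2.
under eq_integral => x _.
  rewrite (_ : (_ ^+ 2)%:E =
    ((c ^+ 2)%:E * ((f x) ^+ 2)%:E + (2 * c * e)%:E * (f x)%:E + (e ^+ 2)%:E)%E).
    over.
  by rewrite -!EFinM -!EFinD; congr EFin; ring.
have i1 : mu.-integrable setT (fun x => (c ^+ 2)%:E * ((f x) ^+ 2)%:E)%E.
  exact: integrableZl.
have i2 : mu.-integrable setT (fun x => (2 * c * e)%:E * (f x)%:E)%E.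
  exact: integrableZl.
have i3 : mu.-integrable setT (fun x => (e ^+ 2)%:E).
  by apply: finite_measure_integrable_cst.
rewrite integralD//; last exact: integrableD.
rewrite integralD// !integralZl// f0 f2 integral_cst//= probability_setT.
by rewrite mule1 mule0 adde0 -EFinM -EFinD.
Qed.

(* Integrating the first observation out first, the cross term vanishes pointwise,
   so no integrability of the remaining sum is needed. *)
Lemma iid_sum_sqr {d} {T : measurableType d} (mu : probability T R) (f : T -> R)
    (s : R) (n : nat) (b : 'I_n -> R) :
  mu.-integrable setT (EFin \o f) ->
  mu.-integrable setT (fun x => ((f x) ^+ 2)%:E) ->
  (\int[mu]_x (f x)%:E = 0)%E -> (\int[mu]_x ((f x) ^+ 2)%:E = s%:E)%E ->
  (\int[iid_law mu n]_z ((\sum_(i < n) b i * f (tnth z i)) ^+ 2)%:E =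
   (\sum_(i < n) b i ^+ 2 * s)%:E)%E.
Proof.
move=> intf intf2 f0 f2.
have mf : measurable_fun setT f by apply/measurable_EFinP; exact: measurable_int intf.
have mS n' (b' : 'I_n' -> R) : measurable_fun setT
    (fun z : n'.-tuple T => \sum_(i < n') b' i * f (tnth z i)).
  apply: measurable_sum => i; apply: measurable_funM => //.
  by apply: measurableT_comp => //; exact: measurable_tnth.
elim: n b => [|n IHn] b.
  rewrite !big_ord0 (eq_integral (cst 0%E)) ?integral0// => z _.
  by rewrite big_ord0 expr0n.
have mh : measurable_fun setT (fun z : n.+1.-tuple T =>
    ((\sum_(i < n.+1) b i * f (tnth z i)) ^+ 2)%:E).
  by apply/measurable_EFinP; apply: measurable_funX; exact: mS.
rewrite ge0_integral_pushforward//; last by move=> z _; rewrite lee_fin sqr_ge0.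
rewrite preimage_setT (fubini_tonelli2); last 2 first.
- by apply: measurableT_comp => //.
- by move=> z; rewrite /= lee_fin sqr_ge0.
have inner (z : n.-tuple T) :
    (\int[mu]_x ((\sum_(i < n.+1) b i * f (tnth (consT (x, z)) i)) ^+ 2)%:E =
     (b ord0 ^+ 2 * s)%:E +
       ((\sum_(i < n) b (lift ord0 i) * f (tnth z i)) ^+ 2)%:E)%E.
  rewrite -EFinD -(integral_affine_sqr _ _ intf intf2 f0 f2).
  apply: eq_integral => x _; rewrite big_ord_recl tnth0.
  by under eq_bigr do rewrite tnthS.
rewrite /fubini_G (eq_integral (fun z : n.-tuple T => (b ord0 ^+ 2 * s)%:E +
    ((\sum_(i < n) b (lift ord0 i) * f (tnth z i)) ^+ 2)%:E)%E); last first.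
  by move=> z _; exact: inner.
rewrite big_ord_recl -/(iid_law mu n).
rewrite ge0_integralD//; last 3 first.
- move=> z _; rewrite lee_fin mulr_ge0 ?sqr_ge0// -lee_fin -f2.
  by apply: integral_ge0 => *; rewrite lee_fin sqr_ge0.
- by move=> z _; rewrite lee_fin sqr_ge0.
- by apply/measurable_EFinP; apply: measurable_funX; exact: mS.
by rewrite IHn integral_cst//= probability_setT mule1 -EFinD.
Qed.

Lemma iid_sum_tail {d} {T : measurableType d} (mu : probability T R) (f : T -> R)
    (s : R) (n : nat) (b : 'I_n -> R) (eps : R) : 0 < eps ->
  mu.-integrable setT (EFin \o f) ->
  mu.-integrable setT (fun x => ((f x) ^+ 2)%:E) ->
  (\int[mu]_x (f x)%:E = 0)%E -> (\int[mu]_x ((f x) ^+ 2)%:E = s%:E)%E ->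
  (iid_law mu n [set z | (eps < `|\sum_(i < n) b i * f (tnth z i)|)%R] <=
   (eps ^- 2 * ((\sum_(i < n) b i ^+ 2) * s))%:E)%E.
Proof.
move=> eps0 intf intf2 f0 f2.
apply: le_trans (sqr_markov _ eps0 _) _.
  apply: measurable_sum => i; apply: measurable_funM => //.
  apply: measurableT_comp => //; last exact: measurable_tnth.
  by apply/measurable_EFinP; exact: measurable_int intf.
by rewrite (iid_sum_sqr _ intf intf2 f0 f2) -EFinM mulr_suml.
Qed.
End second_moments.

(** * Grids and cells in the extended space *)

Section grid.
Context {R : realType} {m : nat}.
Implicit Types (x y : 'cV[\bar R]_m) (H F : 'cV[\bar R]_m -> R).

(** Epsilon-delta form of uniform continuity: [contract] maps the extended line onto [-1, 1] and
    induces its uniform structure. *)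
Definition contract_ucont F := forall eps : R, 0 < eps ->
  exists2 delta : R, 0 < delta & forall x y,
    (forall k, `|contract (x k ord0) - contract (y k ord0)| < delta) ->
    `|F x - F y| < eps.

Lemma unif_continuous_contract F : unif_continuous F -> contract_ucont F.
Proof.
move=> ucF eps eps0.
have entA : entourage [set p : R * R | `|p.1 - p.2| < eps].
  rewrite -entourage_ballE; exists eps => // -[a b] /=.
have [P entP PA] := ucF _ entA.
have entP' : forall k, exists e : R, 0 < e /\
    [set p : \bar R * \bar R | `|contract p.1 - contract p.2| < e] `<=` P k ord0.
  by move=> k; have := entP k ord0; rewrite -entourage_ballE => -[e /= e0 eP]; exists e.
have [e he] := choice entP'.
exists (\big[Num.min/1]_k e k).
  by apply: lt_bigmin => // k _; case: (he k).
move=> x y xy; apply: (PA (x, y)) => k j; rewrite (ord1 j).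
have [_] := he k; apply => /=; apply: lt_le_trans (xy k) _.
exact: bigmin_le_cond.
Qed.

Lemma contract_ucontB F H : contract_ucont F -> contract_ucont H ->
  contract_ucont (fun x => F x - H x).
Proof.
move=> cF cH eps eps0; have eps2 : 0 < eps / 2 by rewrite divr_gt0.
have [d1 d10 h1] := cF _ eps2; have [d2 d20 h2] := cH _ eps2.
exists (Num.min d1 d2); first by rewrite lt_min d10.
move=> x y xy; have := h1 x y; have := h2 x y.
have xy1 k : `|contract (x k ord0) - contract (y k ord0)| < d1.
  by apply: lt_le_trans (xy k) _; rewrite ge_min lexx.
have xy2 k : `|contract (x k ord0) - contract (y k ord0)| < d2.
  by apply: lt_le_trans (xy k) _; rewrite ge_min lexx orbT.
move=> /(_ xy2) h2' /(_ xy1) h1'.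
rewrite (_ : _ - _ = (F x - F y) - (H x - H y)); last by ring.
by apply: le_lt_trans (ler_normB _ _) _; rewrite [eps]splitr ltrD.
Qed.

(* The grid is equidistant in the coordinates [contract], with values in [-1, 1]. *)
Lemma grid_exists F (eps : R) : contract_ucont F -> 0 < eps ->
  exists (I : finType) (lo up : I -> 'cV[\bar R]_m),
  (forall x, exists i, [/\ lev (lo i) x, lev x (up i) &
     forall k, (-oo < x k ord0 -> lo i k ord0 < x k ord0)%E]) /\
  (forall i x y, lev (lo i) x -> lev x (up i) ->
     lev (lo i) y -> lev y (up i) -> `|F x - F y| <= eps).
Proof.
move=> ucF eps0; have [delta delta0 hF] := ucF _ eps0.
(* This choice makes the mesh 2 / N of the grid on [-1, 1] smaller than [delta]. *)
pose N := (Num.trunc (2 / delta)).+1.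
pose s (j : nat) : R := -1 + 2 * (j%:R / N%:R).
have N0 : 0 < N%:R :> R by rewrite ltr0n.
have sE (j : nat) : (j <= N)%N -> contract (expand (s j)) = s j.
  move=> jN; apply: expandK; rewrite inE.
  have : 0 <= j%:R / N%:R :> R by rewrite divr_ge0.
  have : j%:R / N%:R <= 1 :> R by rewrite ler_pdivrMr// mul1r ler_nat.
  by rewrite ler_norml /s => h1 h2; lra.
have cover (e : \bar R) : exists j : 'I_N, [/\ (expand (s j) <= e)%E,
    (e <= expand (s j.+1))%E & (-oo < e -> expand (s j) < e)%E].
  have topN : (e <= expand (s N.-1.+1))%E.
    by rewrite expand1 ?leey// prednK// /s divff ?gt_eqF//; lra.
  have exj : exists j, (e <= expand (s j.+1))%E by exists N.-1.
  (* Taking the least such j makes the left inequality strict, except for j = 0, where the left end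
     is -oo. Points with finite coordinates thus fall into half-open cells. *)
  case: (ex_minnP exj) => j ej minj.
  have jN : (j < N)%N := minj _ topN.
  exists (Ordinal jN); case: j ej minj jN => [|j] ej minj jN /=.
    have -> : expand (s 0) = -oo%E by apply: expandN1; rewrite /s mul0r mulr0 addr0.
    by split=> //; exact: leNye.
  have lt : (expand (s j.+1) < e)%E.
    by rewrite ltNge; apply/negP => /minj; rewrite ltnn.
  by split=> //; exact: ltW.
have close (j : 'I_N) (e e' : \bar R) :
    (expand (s j) <= e)%E -> (e <= expand (s j.+1))%E ->
    (expand (s j) <= e')%E -> (e' <= expand (s j.+1))%E ->
    `|contract e - contract e'| < delta.
  rewrite -4!le_contract !sE ?ltn_ord//; last by rewrite ltnW.
  move=> h1 h2 h3 h4.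
  have step : s j.+1 - s j < delta.
    rewrite /s -natr1 mulrDl; have : 2 * (1 / N%:R) < delta.
      rewrite mulrA mulr1 ltr_pdivrMr// mulrC -ltr_pdivrMr//.
      by rewrite /N; exact: truncnS_gt.
    lra.
  by apply: le_lt_trans step; rewrite ler_norml; apply/andP; split; lra.
exists {ffun 'I_m -> 'I_N}, (fun h : {ffun 'I_m -> 'I_N} => \col_k expand (s (h k))),
  (fun h : {ffun 'I_m -> 'I_N} => \col_k expand (s (h k).+1)); split.
  move=> x; have [h hx] := choice (fun k => cover (x k ord0)).
  exists [ffun k => h k]; split.
  - by apply/forallP => k; rewrite mxE ffunE; case: (hx k).
  - by apply/forallP => k; rewrite mxE ffunE; case: (hx k).
  - by move=> k; rewrite mxE ffunE; case: (hx k).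
move=> h x y /forallP lx /forallP xu /forallP ly /forallP yu.
apply/ltW/hF => k; have := lx k; have := xu k; have := ly k; have := yu k.
by rewrite !mxE => *; exact: (close (h k)).
Qed.

(** The monotonicity step of Glivenko-Cantelli: [H x] lies between the values of [H] at the two
    corners, which are within [eps] of [F], and [F] moves by at most [eps] between a corner and
    [x]. *)
Lemma grid_close (I : finType) (lo up : I -> 'cV[\bar R]_m) F H (eps : R) :
  (forall x y, lev x y -> H x <= H y) ->
  (forall x, exists i, lev (lo i) x /\ lev x (up i)) ->
  (forall i x y, lev (lo i) x -> lev x (up i) ->
     lev (lo i) y -> lev y (up i) -> `|F x - F y| <= eps) ->
  (forall i, `|H (lo i) - F (lo i)| <= eps /\ `|H (up i) - F (up i)| <= eps) ->
  forall x, `|H x - F x| <= eps + eps.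
Proof.
move=> monoH cover osc close x; have [i [lx xu]] := cover x.
have levxx y : lev y y by apply/forallP.
have lu : lev (lo i) (up i).
  by apply/forallP => k; move/forallP: lx => /(_ k) lx; move/forallP: xu => /(_ k); exact: le_trans.
have [cl cu] := close i.
have o1 := osc i (lo i) x (levxx _) lu lx xu.
have o2 := osc i (up i) x lu (levxx _) lx xu.
have H1 := monoH _ _ lx; have H2 := monoH _ _ xu.
move: cl cu o1 o2; rewrite !ler_norml => /andP[? ?] /andP[? ?] /andP[? ?] /andP[? ?].
by apply/andP; split; lra.
Qed.

Definition cell x y : set (m.-tuple R) :=
  [set z | lev (emb z) y /\ forall k, (x k ord0 < (tnth z k)%:E)%E].

Lemma dfunE (mu : probability (m.-tuple R) R) x :
  mu [set z | lev (emb z) x] = (dfun mu x)%:E.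
Proof. by rewrite /dfun fineK// fin_num_measure//; exact: measurable_lev. Qed.

Lemma dfun_ge0 (mu : probability (m.-tuple R) R) x : 0 <= dfun mu x.
Proof. by rewrite -lee_fin -dfunE. Qed.

Lemma dfun_le1 (mu : probability (m.-tuple R) R) x : dfun mu x <= 1.
Proof. by rewrite -lee_fin -dfunE probability_le1//; exact: measurable_lev. Qed.

(* Adding one lower bound to the set removes from it the set of the same form whose
   upper corner is lowered to that bound; hence the factor 2 per bound. *)
Lemma partial_cell_close (mu nu : probability (m.-tuple R) R) (eps : R)
    (s : seq 'I_m) x y :
  (forall z, `|dfun mu z - dfun nu z| <= eps) ->
  let A := [set z : m.-tuple R | lev (emb z) y /\
    forall k, k \in s -> (x k ord0 < (tnth z k)%:E)%E] in
  measurable A /\ `|fine (mu A) - fine (nu A)| <= 2 ^+ size s * eps.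
Proof.
move=> close; elim: s y => [|k s IHs] y /=.
  rewrite (_ : [set _ | _] = [set z | lev (emb z) y]); last first.
    by apply/seteqP; split=> z /= [].
  by split; [exact: measurable_lev|rewrite mul1r; exact: close].
pose y' : 'cV[\bar R]_m :=
  \col_j if j == k then Order.min (y k ord0) (x k ord0) else y j ord0.
have [mA cA] := IHs y; have [mB cB] := IHs y'.
rewrite (_ : [set z | _ /\ (forall j, j \in k :: s -> _)] =
  [set z | lev (emb z) y /\ forall k, k \in s -> (x k ord0 < (tnth z k)%:E)%E] `\`
  [set z | lev (emb z) y' /\ forall k, k \in s -> (x k ord0 < (tnth z k)%:E)%E]); last first.
  apply/seteqP; split=> z /= [zy zx].
    split.
      by split=> // j js; apply: zx; rewrite inE js orbT.
    move=> [/forallP/(_ k)]; rewrite !mxE eqxx le_min => /andP[_ zk] _.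
    by have := zx k; rewrite inE eqxx => /(_ isT); rewrite ltNge zk.
  case: zy => zy zs; split=> // j; rewrite inE => /orP[/eqP ->|]; last exact: zs.
  rewrite ltNge; apply/negP => zk; apply: zx; split=> //.
  apply/forallP => i; rewrite !mxE; case: eqP => [->|_].
    by rewrite le_min zk andbT; move/forallP: zy => /(_ k); rewrite mxE.
  by move/forallP: zy => /(_ i); rewrite mxE.
set A := [set _ | _]; set B := [set _ | _].
have BA : B `<=` A.
  move=> z [zy' zs]; split=> //; apply/forallP => i.
  move/forallP: zy' => /(_ i); rewrite !mxE; case: eqP => [->|//].
  by rewrite le_min => /andP[].
have mD (la : probability (m.-tuple R) R) :
    fine (la (A `\` B)) = fine (la A) - fine (la B).
  rewrite measureD//; last by rewrite (le_lt_trans (probability_le1 _ _)) ?ltry.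
  by rewrite (setIidr BA) fineB// fin_num_measure.
split; first exact: measurableD.
rewrite !mD (_ : _ - _ = (fine (mu A) - fine (nu A)) - (fine (mu B) - fine (nu B))); last by ring.
apply: le_trans (ler_normB _ _) _.
by rewrite exprS -mulrA mulr2n mulrDl mul1r lerD.
Qed.

Lemma measurable_cell x y : measurable (cell x y).
Proof.
rewrite (_ : cell x y = [set z | lev (emb z) y] `&` \bigcap_(k in [set: 'I_m])
    ((@tnth m R)^~ k @^-1` [set r : R | (x k ord0 < r%:E)%E])).
  apply: measurableI; first exact: measurable_lev.
  apply: fin_bigcap_measurable => // k _.
  rewrite -[X in measurable X]setTI; apply: measurable_tnth => //.
  rewrite -[X in measurable X]setTI.
  by apply: emeasurable_fun_o_infty => //; exact: EFin_measurable.
by apply/seteqP; split=> z /= [zy zx]; split=> // k; [move=> _|]; exact: zx.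
Qed.

Lemma cell_close (mu nu : probability (m.-tuple R) R) (eps : R) x y :
  (forall z, `|dfun mu z - dfun nu z| <= eps) ->
  `|fine (mu (cell x y)) - fine (nu (cell x y))| <= 2 ^+ m * eps.
Proof.
move=> close; have [_] := partial_cell_close (enum 'I_m) x y close.
rewrite size_enum_ord (_ : [set _ | _] = cell x y)//.
by apply/seteqP; split=> z /= [zy zx]; split=> // k *; apply: zx; rewrite ?mem_enum.
Qed.

(** By contraposition. On a grid where [D] oscillates by at most e, a cell meeting the set where |D|
    > 2e has |D| > e throughout, so it is null if no cell as claimed exists. Hence the set where |D|
    > 2e is null for each e = 1/(n+1), and so is the union of these sets. *)
Lemma positive_cell (mu : probability (m.-tuple R) R) (D : 'cV[\bar R]_m -> R) :
  contract_ucont D -> ~ {ae mu, forall z, D (emb z) = 0} ->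
  exists (eta : R) x y, [/\ 0 < eta, (0 < mu (cell x y))%E &
    forall z, cell x y z -> eta < `|D (emb z)|].
Proof.
move=> ucD nae; apply: contrapT => none; apply: nae.
have null n : mu.-negligible [set z | 2 * n.+1%:R^-1 < `|D (emb z)|].
  have n0 : 0 < n.+1%:R^-1 :> R by rewrite invr_gt0.
  have [I [lo [up [cover osc]]]] := grid_exists ucD n0.
  (* The finitely many null cells are listed as a sequence padded with empty sets, to use countable
     subadditivity. *)
  pose F n := if unpickle n is Some i then
    (if mu (cell (lo i) (up i)) == 0%E then cell (lo i) (up i) else set0) else set0.
  have negF k : mu.-negligible (F k).
    rewrite /F; case: unpickle => [i|]; last exact: negligible_set0.
    case: eqP => [mu0|_]; last exact: negligible_set0.
    by apply/negligibleP => //; exact: measurable_cell.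
  apply: negligibleS (negligible_bigcup negF).
  move=> z /= Dz; have [i [lz zu ltz]] := cover (emb z).
  have zcell : cell (lo i) (up i) z.
    by split=> // k; have := ltz k; rewrite mxE; apply; exact: ltNyr.
  exists (pickle i) => //; rewrite /F pickleK; case: eqP => // /eqP mu0.
  exfalso; apply: none.
  exists n.+1%:R^-1, (lo i), (up i); split=> //.
    by rewrite lt_neqAle eq_sym mu0 measure_ge0.
  move=> z' [z'u lz'].
  have lez' : lev (lo i) (emb z').
    by apply/forallP => k; rewrite mxE; apply/ltW/lz'.
  have o := osc i _ _ lez' z'u lz zu.
  have := lerB_dist (D (emb z)) (D (emb z')); rewrite distrC.
  by move: Dz o; set e := _^-1; lra.
have := negligible_bigcup null; apply: negligibleS => z /= /eqP Dz.
have : 0 < `|D (emb z)| / 2 by rewrite divr_gt0// normr_gt0.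
move=> /ltr_add_invr[n]; rewrite add0r => nD; exists n => //=.
by move: nD; set e := _^-1; lra.
Qed.

End grid.

(** * Uniform approximation of the limit model near the true parameter *)

Section column_norm.
Context {R : realType} {d : nat}.

Lemma coord_le_norm (x : 'cV[R]_d) k : `|x k ord0| <= `|x|.
Proof.
rewrite [leRHS]/Num.norm/= mx_normrE.
exact: (@le_bigmax_cond _ _ _ 0 (k, ord0) xpredT (fun ij => `|x ij.1 ij.2|)).
Qed.

Lemma col_norm_le (x : 'cV[R]_d) (c : R) : 0 <= c ->
  (forall k, `|x k ord0| <= c) -> `|x| <= c.
Proof.
move=> c0 xc; rewrite [leLHS]/Num.norm/= mx_normrE.
by apply: bigmax_le => // -[i j] _ /=; rewrite (ord1 j).
Qed.

Lemma derive_grad (f : 'cV[R]_d -> R) (u h : 'cV[R]_d) : differentiable f u ->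
  'D_h f u = \sum_k h k ord0 * grad f u k ord0.
Proof.
move=> df; rewrite deriveE//.
have hE : h = \sum_k h k ord0 *: delta_mx k ord0.
  by rewrite [LHS]matrix_sum_delta; apply: eq_bigr => k _; rewrite big_ord1.
rewrite [in LHS]hE linear_sum; apply: eq_bigr => k _.
by rewrite linearZ /= /grad mxE deriveE.
Qed.

(** Mean value theorem on the segment from [u] to [u + h]. The factor [d] arises because the
    directional derivative is a sum of [d] terms, each at most M times the maximum norm of [h]. *)
Lemma col_mean_value_bound (f : 'cV[R]_d -> R) (u h : 'cV[R]_d) (M : R) :
  (forall s : R, s \in `[0, 1] -> differentiable f (u + s *: h) /\
     forall k, `|grad f (u + s *: h) k ord0| <= M) ->
  `|f (u + h) - f u| <= d%:R * M * `|h|.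
Proof.
move=> df; pose phi (s : R) := f (u + s *: h).
have dphi (s : R) : s \in `[0, 1] -> is_derive s 1 phi ('D_h f (u + s *: h)).
  move=> s01; have [dfs _] := df s s01.
  have E : (fun t : R => t^-1 *: ((phi \o shift s) (t *: (1 : R)) - phi s)) =
      (fun t => t^-1 *: ((f \o shift (u + s *: h)) (t *: h) - f (u + s *: h))).
    apply/funext => t; rewrite /phi /=; congr (_ *: (f _ - _)).
    by rewrite [t *: 1]mulr1 scalerDl addrCA.
  split; first by rewrite /derivable E; exact: diff_derivable.
  by rewrite /derive E.
have cphi : {within `[0, 1], continuous phi}.
  apply: derivable_within_continuous => s s01.
  by have [] := dphi s s01.
have dphi' (s : R) : s \in `]0, 1[ -> is_derive s 1 phi ('D_h f (u + s *: h)).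
  by rewrite in_itv /= => /andP[/ltW s0 /ltW s1]; apply: dphi; rewrite in_itv /= s0.
pose dphi_ (s : R) : R := 'D_h f (u + s *: h).
have [c c01] : exists2 c : R, c \in `[0, 1] & phi 1 - phi 0 = dphi_ c * (1 - 0).
  exact: (@MVT_segment R phi dphi_ 0 1 ler01 dphi' cphi).
rewrite /phi scale0r addr0 scale1r subr0 mulr1 /dphi_ => ->.
have [dfc gc] := df c c01.
rewrite derive_grad// (le_trans (ler_norm_sum _ _ _))//.
apply: (@le_trans _ _ (\sum_(k < d) M * `|h|)).
  apply: ler_sum => k _; rewrite normrM mulrC ler_pM//; exact: coord_le_norm.
by rewrite sumr_const card_ord -[leLHS]mulr_natl mulrA.
Qed.

End column_norm.

Section model_closeness.
Context {R : realType} {m d : nat}.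

Lemma uniform_cvg_le {S : choiceType} {V : normedModType R} (A : set S)
    (f : nat -> S -> V) (h : S -> V) (eps : R) : 0 < eps ->
  {uniform A, f @ \oo --> h} ->
  \forall n \near \oo, forall x, A x -> `|h x - f n x| < eps.
Proof.
move=> eps0 fh; apply: (fh [set k | forall x, A x -> `|h x - k x| < eps]).
apply/uniform_nbhs; exists [set p | `|p.1 - p.2| < eps]; split=> //.
by rewrite -entourage_ballE; exists eps => // -[p q]; rewrite -ball_normE.
Qed.

(** For all large n the gradients of the models are bounded on one ball around [theta], uniformly in
    x. The models are then Lipschitz there with a common constant, so that convergence at [theta]
    alone extends to the ball. *)
Lemma model_close (Theta U : set 'cV[R]_d) (theta : 'cV[R]_d)
    (Gn : nat -> 'cV[\bar R]_m -> 'cV[R]_d -> R) (G : 'cV[\bar R]_m -> R)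
    (g : 'cV[\bar R]_m -> 'cV[R]_d -> 'cV[R]_d) (eps : R) :
  C1 Theta U theta Gn -> C2 U theta Gn g ->
  {uniform, (fun n => Gn n ^~ theta) @ \oo --> G} -> 0 < eps ->
  exists2 delta : R, 0 < delta & \forall n \near \oo, forall u,
    `|u - theta| < delta -> U u /\ forall x, `|Gn n x u - G x| <= eps.
Proof.
move=> [oU _ _ Uth dG] [gn_g ucg bg] GnG eps0.
have eps2 : 0 < eps / 2 by rewrite divr_gt0.
have [r r0 ballU] : exists2 r, 0 < r & forall u, `|u - theta| < r -> U u.
  have /nbhs_ballP[r r0 rU] : nbhs theta U by exact: open_nbhs_nbhs.
  exists r => // u ur; apply: rU; rewrite -ball_normE /ball_ /=.
  by rewrite distrC.
have [M hM] := choice bg.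
pose M1 := \big[Num.max/0]_k M k.
have M1P x k : `|g x theta k ord0| <= M1.
  by apply: le_trans (hM k x) _; exact: le_bigmax_cond.
have M10 : 0 <= M1 by exact: bigmax_ge_id.
have [r' r'0 gclose] : exists2 r', 0 < r' &
    forall x u, U u -> `|u - theta| < r' -> `|g x u - g x theta| < 1.
  have entE : entourage [set p : 'cV[R]_d * 'cV[R]_d | `|p.1 - p.2| < 1].
    rewrite -entourage_ballE; exists 1; first exact: ltr01.
    by move=> -[p q]; rewrite -ball_normE.
  have := ucg _ entE; rewrite /within /= => -[[P Q] [/= entP entQ] PQ].
  move: entQ; rewrite -entourage_ballE => -[r' r'0 r'Q].
  exists r' => // x u Uu ur.
  (* The two points share the coordinate x, so reflexivity of its entourage makes the radius
     independent of x. *)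
  have /PQ [[[xa ua] [xb ub]]/= Hp [xaE uaE xbE ubE]] :
      (P `*` Q) ((x, x), (u, theta)).
    split; first exact: entourage_refl.
    by apply: r'Q; rewrite -ball_normE.
  by move: Hp; rewrite uaE xaE ubE xbE; apply.
(* [M1] bounds g at [theta]; one unit pays for moving from [theta] to a nearby parameter, the other
   for replacing g by the gradient of the n-th model. *)
pose L := d%:R * (M1 + 2).
have L0 : 0 <= L by rewrite mulr_ge0// addr_ge0.
pose delta := Num.min (Num.min r r') (eps / 2 / (L + 1)).
have L1 : 0 < L + 1 by rewrite ltr_wpDl.
exists delta; first by rewrite !lt_min r0 r'0 divr_gt0.
near=> n => u; rewrite !lt_min => /andP[/andP[ur ur'] uL].
have Uu := ballU _ ur; split=> // x.
have n0 : (0 < n)%N by near: n; exact: nbhs_infty_gt.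
have h1 : `|G x - Gn n x theta| < eps / 2.
  by move: x; near: n; apply: filterS (uniform_cvg_le eps2 GnG) => n h x; exact: h.
have h2 v : U v -> `|g x v - grad (Gn n x) v| < 1.
  move=> Uv; suff : (forall xu : 'cV[\bar R]_m * 'cV[R]_d, ([set: _] `*` U) xu ->
    `|g xu.1 xu.2 - grad (Gn n xu.1) xu.2| < 1) by move=> /(_ (x, v)); apply; split.
  by near: n; apply: (uniform_cvg_le _ gn_g).
have h3 : `|Gn n x (theta + (u - theta)) - Gn n x theta| <= L * `|u - theta|.
  apply: col_mean_value_bound => s; rewrite in_itv /= => /andP[s0 s1].
  have near_th q : `|u - theta| < q -> `|theta + s *: (u - theta) - theta| < q.
    rewrite addrAC subrr add0r normrZ ger0_norm//; apply: le_lt_trans.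
    by rewrite ler_piMl.
  have Us : U (theta + s *: (u - theta)) by apply/ballU/near_th.
  have [dn _] := dG n x n0 _ Us; split=> // k.
  have k1 := le_lt_trans (coord_le_norm _ k) (h2 _ Us).
  have k2 := le_lt_trans (coord_le_norm _ k) (gclose x _ Us (near_th _ ur')).
  have := M1P x k; move: k1 k2; rewrite !mxE.
  set p := 'D__ _ _; set q := g _ _ _ _; set q' := g _ _ _ _.
  rewrite !ltr_norml !ler_norml => /andP[? ?] /andP[? ?] /andP[? ?].
  by apply/andP; split; lra.
have h4 : L * `|u - theta| <= eps / 2.
  have : (L + 1) * `|u - theta| <= eps / 2 by rewrite mulrC -ler_pdivlMr// ltW.
  by apply: le_trans; rewrite ler_wpM2r// lerDl.
move: h3; rewrite (addrC theta) subrK => h3.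
have := ler_normD (Gn n x u - Gn n x theta) (Gn n x theta - G x).
by move: h1; rewrite addrA subrK distrC; lra.
Unshelve. all: end_near.
Qed.

End model_closeness.

(** * From sequences of parameters to balls *)

Section uniformization.
Context {R : realType} {d : nat}.

(* A failure along all balls around [theta] yields failures at increasing indices, which
   are spliced into a single sequence converging to [theta]. *)
Lemma sequential_uniform (Theta : set 'cV[R]_d) (theta : 'cV[R]_d)
    (Q : nat -> 'cV[R]_d -> Prop) : Theta theta ->
  (forall un : nat -> 'cV[R]_d, (forall n, Theta (un n)) ->
    un @ \oo --> theta -> \forall n \near \oo, Q n (un n)) ->
  exists2 delta : R, 0 < delta & \forall n \near \oo, forall u,
    Theta u -> `|u - theta| < delta -> Q n u.
Proof.
move=> Tth seqQ; apply: contrapT => none.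
have bad (kN : nat * nat) : exists nu : nat * 'cV[R]_d,
    [/\ (kN.2 <= nu.1)%N, Theta nu.2, `|nu.2 - theta| < kN.1.+1%:R^-1 & ~ Q nu.1 nu.2].
  apply: contrapT => nobad; apply: none; exists kN.1.+1%:R^-1; first by rewrite invr_gt0.
  exists kN.2 => // n /= Nn u Tu ud; apply: contrapT => nQ; apply: nobad.
  by exists (n, u); split.
have [f hf] := choice bad.
(* [N k] exceeds all failure indices found before stage k. The k-th failure is sought from there on,
   within 1/(k+1) of [theta], so the indices strictly increase. *)
pose fix N k := if k is k'.+1 then (f (k', N k')).1.+1 else 0%N.
pose idx k := (f (k, N k)).1.
have idxN k : (N k <= idx k)%N by have [] := hf (k, N k).
have NS k : (N k < N k.+1)%N by rewrite /= ltnS; exact: idxN.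
have Nmono : {homo N : i j / (i <= j)%N}.
  by apply: homo_leq => //; [exact: leq_trans|move=> k; exact: ltnW].
have kidx k : (k <= idx k)%N.
  apply: leq_trans (idxN k); elim: k => // k /leq_ltn_trans; apply; exact: NS.
have idx_lt i j : (i < j)%N -> (idx i < idx j)%N.
  by move=> ij; apply: leq_trans (idxN j); apply: leq_trans (Nmono _ _ ij).
(* At a failure index the failing parameter is used, elsewhere [theta]. Strict monotonicity of [idx]
   makes the stage k unique. *)
pose un n := if pselect (exists k, idx k = n) is left e
  then (f (projT1 (cid e), N (projT1 (cid e)))).2 else theta.
have unT n : Theta (un n).
  by rewrite /un; case: pselect => // e; have [] := hf (projT1 (cid e), N (projT1 (cid e))).
have uncvg : un @ \oo --> theta.
  apply/cvgrPdist_lt => eps eps0.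
  have [k0 _ k0P] := near_infty_natSinv_lt (PosNum eps0).
  exists (idx k0) => // n /= k0n; rewrite /un distrC.
  case: pselect => [e|_]; last by rewrite subrr normr0.
  case: (cid e) => k /= kn.
  have [_ _ + _] := hf (k, N k); move/lt_trans; apply; apply: k0P => /=.
  by rewrite leqNgt; apply/negP => /idx_lt; rewrite kn ltnNge k0n.
have [n0 _ n0P] := seqQ un unT uncvg.
have := n0P (idx n0) (kidx n0); rewrite /un; case: pselect => [e|[]]; last by exists n0.
case: (cid e) => k /= kn.
have -> : k = n0.
  by apply/eqP; case: ltngtP => // /idx_lt; rewrite kn ltnn.
by have [_ _ _] := hf (n0, N n0).
Qed.

End uniformization.

(** * Probabilities tending to zero and finite unions *)

Section vanishing.
Context {R : realType}.
Implicit Types p q : nat -> \bar R.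

(** A one-sided form of convergence to 0, sufficient for nonnegative sequences. It passes to
    eventually dominated sequences without any finiteness to check. *)
Definition vanishing p := forall eta : R, 0 < eta -> \forall n \near \oo, (p n <= eta%:E)%E.

Lemma cvg_vanishing p : p @ \oo --> 0%E -> vanishing p.
Proof.
move=> /fine_cvgP[fp /cvgrPdist_le cp] eta eta0.
near=> n; have fpn : p n \is a fin_num by near: n.
rewrite -(fineK fpn) lee_fin (le_trans (ler_norm _))// -normrN -[X in `|X|]add0r.
by near: n; exact: cp.
Unshelve. all: end_near. Qed.

Lemma vanishing_EFin (r : nat -> R) : r @ \oo --> 0 -> vanishing (EFin \o r).
Proof.
move=> /cvgrPdist_le cr eta eta0; near=> n; rewrite /= lee_fin.
rewrite (le_trans (ler_norm _))// -normrN -[X in `|X|]add0r.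
by near: n; exact: cr.
Unshelve. all: end_near. Qed.

Lemma vanishing_le p q : (\forall n \near \oo, (p n <= q n)%E) ->
  vanishing q -> vanishing p.
Proof.
move=> pq vq eta eta0; near=> n; apply: (@le_trans _ _ (q n)); near: n => //.
exact: vq.
Unshelve. all: end_near. Qed.

Lemma vanishingD p q : vanishing p -> vanishing q -> vanishing (fun n => p n + q n)%E.
Proof.
move=> vp vq eta eta0; have eta2 : 0 < eta / 2 by rewrite divr_gt0.
near=> n; rewrite [eta]splitr EFinD leeD//; near: n; [exact: vp|exact: vq].
Unshelve. all: end_near. Qed.

Lemma vanishing_sum (I : Type) (s : seq I) (p : I -> nat -> \bar R) :
  (forall i, vanishing (p i)) -> vanishing (fun n => \sum_(i <- s) p i n)%E.
Proof.
move=> vp; elim: s => [|i s IHs].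
  by move=> eta eta0; near=> n; rewrite big_nil lee_fin ltW.
move=> eta eta0; have := vanishingD (vp i) IHs eta0; apply: filterS => n.
by rewrite big_cons.
Unshelve. all: end_near. Qed.

Lemma measure_bigsetU_le {dT} {T : measurableType dT} (P : probability T R)
    (I : Type) (s : seq I) (A : I -> set T) : (forall i, measurable (A i)) ->
  (P (\big[setU/set0]_(i <- s) A i) <= \sum_(i <- s) P (A i))%E.
Proof.
move=> mA; elim: s => [|i s IHs]; first by rewrite !big_nil measure0.
rewrite !big_cons (le_trans (measureU2 _ _ _))//; last by rewrite leeD2l.
exact: bigsetU_measurable.
Qed.

Lemma fin_unionE {T : Type} (I : finType) (A : I -> set T) :
  [set z | exists i, A i z] = \big[setU/set0]_i A i.
Proof.
apply/seteqP; split=> z /=; last by rewrite -bigcup_seq => -[i _ Az]; exists i.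
by move=> [i Az]; rewrite (bigD1 i)//=; left.
Qed.

Lemma measurable_fin_union {dT} {T : measurableType dT} (I : finType)
    (A : I -> set T) : (forall i, measurable (A i)) ->
  measurable [set z | exists i, A i z].
Proof. by move=> mA; rewrite fin_unionE; exact: bigsetU_measurable. Qed.

Lemma measure_fin_union_le {dT} {T : measurableType dT} (P : probability T R)
    (I : finType) (A : I -> set T) : (forall i, measurable (A i)) ->
  (P [set z | exists i, A i z] <= \sum_i P (A i))%E.
Proof. by move=> mA; rewrite fin_unionE; exact: measure_bigsetU_le. Qed.

End vanishing.

Section column_measurability.
Context {R : realType} {d : nat} {dT} {T : measurableType dT}.

Lemma measurable_coord (f : T -> 'cV[R]_d) k :
  measurable_fun setT (f : _ -> g_sigma_algebraType (@open 'cV[R]_d)) ->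
  measurable_fun setT (fun z => f z k ord0).
Proof.
move=> mf.
apply: (@measurability _ _ _ _ _ _ (@RGenOInfty.G R)); first exact: RGenOInfty.measurableE.
move=> _ [_ [r ->] <-]; rewrite setTI.
have := mf measurableT [set x : 'cV[R]_d | r < x k ord0].
rewrite setTI; move=> H.
rewrite (_ : _ @^-1` _ = f @^-1` [set x : 'cV[R]_d | r < x k ord0]); last first.
  by apply/seteqP; split=> z /=; rewrite in_itv/= andbT.
apply: H; apply: sub_sigma_algebra.
have -> : [set x : 'cV[R]_d | r < x k ord0] =
  (fun x : 'cV[R]_d => x k ord0) @^-1` [set y | r < y] by [].
apply: open_comp; last exact: open_gt.
by move=> x _; exact: coord_continuous.
Qed.

(** The maximum norm exceeds [eps] exactly when some coordinate does, so only real-valued functions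
    have to be measurable, not vector-valued sums and differences. *)
Lemma measurable_norm_gt (f : T -> 'cV[R]_d) (eps : R) : 0 <= eps ->
  (forall k, measurable_fun setT (fun z => f z k ord0)) ->
  measurable [set z | eps < `|f z|].
Proof.
move=> eps0 mf.
have mA k : measurable [set z | eps < `|f z k ord0|] by exact: measurable_abs_gt.
rewrite (_ : [set _ | _] = \big[setU/set0]_k [set z | eps < `|f z k ord0|]).
  exact: bigsetU_measurable.
apply/seteqP; split=> z /=.
  move=> fz; rewrite -bigcup_seq; apply: contrapT => none.
  move: fz; apply/negP; rewrite -leNgt; apply: col_norm_le => // k.
  by rewrite leNgt; apply/negP => fzk; apply: none; exists k => //=; rewrite mem_index_enum.
by rewrite -bigcup_seq => -[k _ /=] /lt_le_trans; apply; exact: coord_le_norm.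
Qed.

End column_measurability.

(** * Weak laws of large numbers *)

Section null.
Context {R : realType} {m d : nat}.
Variables (a : nat -> nat -> R) (kappa : R).
Hypothesis a_sum1 : forall n, (0 < n)%N -> \sum_(i < n) a i n = 1.
Hypothesis a_sqr : n%:R * \sum_(i < n) a i n ^+ 2 @[n --> \oo] --> kappa.

Lemma sum_sqr_weights_cvg0 : \sum_(i < n) a i n ^+ 2 @[n --> \oo] --> (0 : R).
Proof.
have inv0 : n%:R^-1 @[n --> \oo] --> (0 : R).
  by rewrite -cvg_shiftS; exact: cvg_harmonic.
rewrite -[X in _ --> X](mul0r kappa); apply: cvg_trans (cvgM inv0 a_sqr); apply: near_eq_cvg.
near=> n; have n0 : (0 < n)%N by near: n; exact: nbhs_infty_gt.
have nn0 : n%:R != 0 :> R by rewrite pnatr_eq0 -lt0n.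
by rewrite /= mulrA mulVf// mul1r.
Unshelve. all: end_near. Qed.

Lemma wedfB n (z : n.-tuple (m.-tuple R)) x (c : R) : (0 < n)%N ->
  wedf a z x - c = \sum_(i < n) a i n * ((lev (emb (tnth z i)) x)%:R - c).
Proof.
move=> n0; under eq_bigr do rewrite mulrBr.
by rewrite sumrB -mulr_suml a_sum1// mul1r.
Qed.

Lemma measurable_wedf n x :
  measurable_fun setT (fun z : n.-tuple (m.-tuple R) => wedf a z x).
Proof.
apply: measurable_sum => i; apply: measurable_funM => //.
apply: (measurableT_comp (measurable_fun_lev x)); exact: measurable_tnth.
Qed.

Lemma integral_lev (mu : probability (m.-tuple R) R) x :
  (\int[mu]_y ((lev (emb y) x)%:R : R)%:E = (dfun mu x)%:E)%E.
Proof.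
rewrite -dfunE -[X in mu X]setIT -integral_indic//; last exact: measurable_lev.
by apply: eq_integral => z _; rewrite lev_indic.
Qed.

Lemma iid_wedf_tail (mu : probability (m.-tuple R) R) n x (eps : R) :
  (0 < n)%N -> 0 < eps ->
  (iid_law mu n [set z | (eps < `|wedf a z x - dfun mu x|)%R] <=
   (eps ^- 2 * \sum_(i < n) a i n ^+ 2)%:E)%E.
Proof.
move=> n0 eps0; pose f (y : m.-tuple R) : R := (lev (emb y) x)%:R - dfun mu x.
have mf : measurable_fun setT f by apply: measurable_funB => //; exact: measurable_fun_lev.
have f1 y : `|f y| <= 1.
  have := dfun_ge0 mu x; have := dfun_le1 mu x.
  by rewrite /f ler_norml; case: lev => /= ? ?; apply/andP; split; lra.
have f21 y : `|f y ^+ 2| <= 1 by rewrite normrX exprn_ile1.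
have intf : mu.-integrable setT (EFin \o f) by apply: bounded_integrable => //; exists 1.
have intf2 : mu.-integrable setT (fun y => (f y ^+ 2)%:E).
  by apply: (@bounded_integrable _ _ _ _ (fun y => f y ^+ 2)); [exact: measurable_funX|exists 1].
have intl : mu.-integrable setT (fun y => ((lev (emb y) x)%:R : R)%:E).
  apply: (@bounded_integrable _ _ _ _ (fun y => (lev (emb y) x)%:R)).
    exact: measurable_fun_lev.
  by exists 1 => y; case: lev; rewrite ?normr1 ?normr0.
have f0 : (\int[mu]_y (f y)%:E = 0)%E.
  rewrite /f; under eq_integral do rewrite EFinB.
  rewrite integralB//; last exact: finite_measure_integrable_cst.
  by rewrite integral_lev integral_cst//= probability_setT mule1 subee.
have f2 : (\int[mu]_y (f y ^+ 2)%:E = (fine (\int[mu]_y (f y ^+ 2)%:E))%:E)%E.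
  by rewrite fineK//; exact: integrable_fin_num.
have s1 : fine (\int[mu]_y (f y ^+ 2)%:E)%E <= 1.
  rewrite -lee_fin -f2 -[leRHS](_ : (\int[mu]_y (cst 1%E y) = 1)%E); last first.
    by rewrite integral_cst//= probability_setT mule1.
  apply: ge0_le_integralT => y; first by rewrite lee_fin sqr_ge0.
  by rewrite lee_fin (le_trans (ler_norm _)).
have := iid_sum_tail (fun i : 'I_n => a i n) eps0 intf intf2 f0 f2.
rewrite (_ : [set z | _] = [set z : n.-tuple _ | eps < `|wedf a z x - dfun mu x|]); last first.
  by apply/seteqP; split=> z /=; rewrite wedfB.
move=> /le_trans; apply; rewrite lee_fin ler_wpM2l ?invr_ge0 ?exprn_ge0 ?(ltW eps0)//.
by rewrite ler_piMr// sumr_ge0// => i _; exact: sqr_ge0.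
Qed.

Variables (Theta U : set 'cV[R]_d) (theta : 'cV[R]_d).
Variables (Gn : nat -> 'cV[\bar R]_m -> 'cV[R]_d -> R).
Variables (t : forall n, n.-tuple (m.-tuple R) -> 'cV[R]_d).
Arguments t : clear implicits.
Hypothesis t_meas : forall n, (0 < n)%N ->
    measurable_fun setT (t n : _ -> g_sigma_algebraType (@open 'cV[R]_d)).
Variables (un : nat -> 'cV[R]_d) (v : 'M[R]_d) (w : 'cV[\bar R]_m -> 'cV[R]_d).
Variable l : nat -> m.-tuple R -> 'cV[R]_d -> 'cV[R]_d.
Hypotheses (oU : open U) (Uth : U theta) (un_cvg : un @ \oo --> theta).
Hypotheses (hC5 : C5 a U Gn t un l) (hC6 : C6 a Gn un l v w).

(** The error of the estimator splits into the C5 remainder, the weighted sum of the [l n] and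
    [un n - theta]. The k-th coordinate of the sum has second moment equal to the sum of squared
    weights times the (k, k) entry of [vfun], which converges by C6. *)
Lemma null_estimator (eps : R) : 0 < eps ->
  vanishing (fun n => iid_law (dlaw (Gn n ^~ (un n))) n
    [set z | eps < `|t n z - theta|]).
Proof.
move=> eps0; have eps4 : 0 < eps / 4 by rewrite divr_gt0.
have [lP lexp] := hC5; have [vcvg _ _] := hC6.
pose mu n := dlaw (Gn n ^~ (un n)).
pose A n := [set z : n.-tuple (m.-tuple R) | eps / 4 <
  `|Num.sqrt n%:R *: (t n z - un n) -
        Num.sqrt n%:R *: \sum_(i < n) a i n *: l n (tnth z i) (un n)|].
pose B n k := [set z : n.-tuple (m.-tuple R) | eps / 4 <
  `|\sum_(i < n) a i n * l n (tnth z i) (un n) k ord0|].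
pose sv n k : R := (eps / 4) ^- 2 * ((\sum_(i < n) a i n ^+ 2) *
  vfun (Gn n) (l n) (un n) k k).
apply: (@vanishing_le _ _ (fun n => iid_law (mu n) n (A n) + \sum_k (sv n k)%:E)%E); last first.
  apply: vanishingD; first exact/cvg_vanishing/lexp.
  apply: vanishing_sum => k; apply: vanishing_EFin.
  rewrite -[X in _ --> X](_ : (eps / 4) ^- 2 * (0 * v k k) = 0); last by rewrite mul0r mulr0.
  apply: cvgM; [exact: cvg_cst|apply: cvgM]; first exact: sum_sqr_weights_cvg0.
  exact: (cvg_comp _ _ vcvg (@coord_continuous _ _ _ k k v)).
(* The moment conditions of C5 are available only on [U], which the sequence eventually enters. *)
have Uun : \forall n \near \oo, U (un n) by apply: un_cvg; exact: open_nbhs_nbhs.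
near=> n; have n0 : (0 < n)%N by near: n; exact: nbhs_infty_gt.
have Un : U (un n) by near: n.
have undist : `|un n - theta| <= eps / 4.
  by rewrite distrC; near: n; move/cvgrPdist_le : un_cvg; apply.
have [ml intl intll l0] := lP n (un n) n0 Un.
have mlk k : measurable_fun setT (fun y => l n y (un n) k ord0) by exact: measurable_coord.
have mS k : measurable_fun setT (fun z : n.-tuple (m.-tuple R) =>
    \sum_(i < n) a i n * l n (tnth z i) (un n) k ord0).
  apply: measurable_sum => i; apply: measurable_funM => //.
  apply: (measurableT_comp (mlk k)); exact: measurable_tnth.
have mt k : measurable_fun setT (fun z => t n z k ord0) by apply: measurable_coord; exact: t_meas.
have Sk z k : (\sum_(i < n) a i n *: l n (tnth z i) (un n)) k ord0 =
    \sum_(i < n) a i n * l n (tnth z i) (un n) k ord0.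
  by rewrite summxE; apply: eq_bigr => i _; rewrite mxE.
have mA : measurable (A n).
  apply: measurable_norm_gt; first exact: ltW.
  move=> k; under eq_fun do rewrite !mxE Sk.
  apply: measurable_funB; apply: measurable_funM => //.
  exact: measurable_funB.
have mB k : measurable (B n k) by exact: measurable_abs_gt.
have mBU := measurable_fin_union mB.
have BUle := measure_fin_union_le (iid_law (mu n) n) mB.
have tailB k : (iid_law (mu n) n (B n k) <= (sv n k)%:E)%E.
  apply: (@iid_sum_tail _ _ _ (mu n) (fun y => l n y (un n) k ord0) _ n (fun i => a i n)) => //.
  - exact: intl.
  - by under eq_fun do rewrite expr2; exact: intll.
  - by rewrite -[RHS](congr1 EFin (l0 k)) fineK//; exact: integrable_fin_num (intl k).
  - under eq_integral do rewrite expr2.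
    by rewrite mxE fineK//; exact: integrable_fin_num (intll k k).
apply: (@le_trans _ _ (iid_law (mu n) n (A n `|` [set z | exists k, B n k z]))).
  apply: le_measure; rewrite ?inE//; [|exact: measurableU|].
    apply: measurable_norm_gt; first exact: ltW.
    by move=> k; under eq_fun do rewrite !mxE; exact: measurable_funB.
  move=> z /= tz; apply: contrapT => /not_orP[nA nB]; move: tz; apply/negP; rewrite -leNgt.
  have hA : `|t n z - un n - \sum_(i < n) a i n *: l n (tnth z i) (un n)| <= eps / 4.
    have : `|Num.sqrt n%:R *: (t n z - un n) -
      Num.sqrt n%:R *: \sum_(i < n) a i n *: l n (tnth z i) (un n)| <= eps / 4.
      by rewrite leNgt; apply/negP.
    (* The factor sqrt n is at least 1, so dropping it only decreases the norm. *)
    rewrite -scalerBr normrZ; apply: le_trans; rewrite ler_peMl//.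
    by rewrite ger0_norm ?sqrtr_ge0// -[leLHS]sqrtr1 ler_wsqrtr// ler1n.
  have hB : `|\sum_(i < n) a i n *: l n (tnth z i) (un n)| <= eps / 4.
    apply: col_norm_le => [|k]; first exact: ltW.
    by rewrite Sk leNgt; apply/negP => Bk; apply: nB; exists k.
  rewrite (_ : _ - _ = (t n z - un n - \sum_(i < n) a i n *: l n (tnth z i) (un n)) +
    (\sum_(i < n) a i n *: l n (tnth z i) (un n) + (un n - theta))).
    apply: le_trans (ler_normD _ _) _.
    have := ler_normD (\sum_(i < n) a i n *: l n (tnth z i) (un n)) (un n - theta).
    lra.
  by rewrite addrA subrK addrA subrK.
apply: le_trans (measureU2 _ _ _) _ => //.
by rewrite leeD2l// (le_trans BUle)// lee_sum.
Unshelve. all: end_near. Qed.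

Hypothesis Gn_df : forall n u, (0 < n)%N -> Theta u -> is_dfun (Gn n ^~ u).
Hypothesis un_Theta : forall n, Theta (un n).

Lemma null_wedf x (eps : R) : 0 < eps ->
  vanishing (fun n => iid_law (dlaw (Gn n ^~ (un n))) n
    [set z | eps < `|wedf a z x - Gn n x (un n)|]).
Proof.
move=> eps0; apply: (@vanishing_le _ _ (EFin \o (fun n => eps ^- 2 * \sum_(i < n) a i n ^+ 2))).
  near=> n; have n0 : (0 < n)%N by near: n; exact: nbhs_infty_gt.
  have := iid_wedf_tail (dlaw (Gn n ^~ (un n))) x n0 eps0.
  by rewrite dlawK//; exact: Gn_df.
apply: vanishing_EFin.
rewrite -[X in _ --> X](mulr0 (eps ^- 2)).
by apply: cvgM; [exact: cvg_cst|]; exact: sum_sqr_weights_cvg0.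
Unshelve. all: end_near. Qed.

End null.

(** * Chebyshev bound for weighted sums of pairwise independent events *)

Section independent_sum.
Context {R : realType} {dT} {T : measurableType dT} (P : probability T R).

Lemma Rintegral_indic (A : set T) : measurable A -> \int[P]_x (\1_A x : R) = fine (P A).
Proof. by move=> mA; rewrite /Rintegral integral_indic// setIT. Qed.

Lemma Rintegral_centered_indicM (A B : set T) : measurable A -> measurable B ->
  P (A `&` B) = (P A * P B)%E ->
  \int[P]_x ((\1_A x - fine (P A)) * (\1_B x - fine (P B)) : R) = 0.
Proof.
move=> mA mB AB.
set p := fine (P A); set q := fine (P B).
have ind1 (C : set T) x : `|\1_C x : R| <= 1.
  by rewrite indicE; case: (_ \in _); rewrite ?normr1 ?normr0.
have intC (C : set T) (c : R) : measurable C -> P.-integrable setT (EFin \o (fun x => c * \1_C x)).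
  move=> mC; apply: bounded_integrable.
    by apply: measurable_funM => //; exact: measurable_indic.
  by exists `|c| => x; rewrite normrM ler_piMr.
have mAB : measurable (A `&` B) by exact: measurableI.
under eq_Rintegral => x _.
  rewrite (_ : _ * _ = (1 * \1_(A `&` B) x + (- q) * \1_A x) +
      ((- p) * \1_B x + p * q * \1_setT x)); last first.
    by rewrite indicI indicT /=; ring.
  over.
have iD f g : P.-integrable setT (EFin \o f) -> P.-integrable setT (EFin \o g) ->
    P.-integrable setT (EFin \o (fun x => f x + g x)).
  by move=> intf intg; exact: (integrableD measurableT intf intg).
have intI (C : set T) : measurable C -> P.-integrable setT (EFin \o (\1_C : T -> R)).
  move=> mC; apply: bounded_integrable; first exact: measurable_indic.
  by exists 1.
have [iAB iA iB iT] : [/\ P.-integrable setT (EFin \o (fun x => 1 * \1_(A `&` B) x)),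
    P.-integrable setT (EFin \o (fun x => (- q) * \1_A x)),
    P.-integrable setT (EFin \o (fun x => (- p) * \1_B x)) &
    P.-integrable setT (EFin \o (fun x => p * q * \1_setT x))].
  by split; exact: intC.
have i1 := iD _ _ iAB iA; have i2 := iD _ _ iB iT.
rewrite (RintegralD measurableT i1 i2) (RintegralD measurableT iAB iA).
rewrite (RintegralD measurableT iB iT).
rewrite !RintegralZl//; [|exact: intI..].
rewrite !Rintegral_indic// AB fineM ?fin_num_measure// probability_setT/= -/p -/q.
ring.
Qed.

Variables (A : nat -> set T) (b : nat -> R).
Hypothesis mA : forall i, measurable (A i).
Hypothesis indepA : forall i j, i != j -> P (A i `&` A j) = (P (A i) * P (A j))%E.

Let Y i x : R := \1_(A i) x - fine (P (A i)).

Lemma centered_indic_bounded i x : `|Y i x| <= 1.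
Proof.
have p1 : fine (P (A i)) <= 1 by rewrite -lee_fin fineK ?fin_num_measure ?probability_le1.
have p0 : 0 <= fine (P (A i)) by exact: fine_ge0.
by rewrite /Y indicE ler_norml; case: (_ \in _) => /=; apply/andP; split; lra.
Qed.

Lemma measurable_centered_indic i : measurable_fun setT (Y i).
Proof. by apply: measurable_funB => //; exact: measurable_indic. Qed.

Let S n x := \sum_(i < n) b i * Y i x.

Lemma measurable_centered_sum n : measurable_fun setT (S n).
Proof.
by apply: measurable_sum => i; apply: measurable_funM => //; exact: measurable_centered_indic.
Qed.

Lemma centered_sum_bounded n x : `|S n x| <= \sum_(i < n) `|b i|.
Proof.
apply: le_trans (ler_norm_sum _ _ _) _; apply: ler_sum => i _.
by rewrite normrM ler_piMr// centered_indic_bounded.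
Qed.

Lemma centered_sum_uncorrelated n k : (n <= k)%N -> \int[P]_x (S n x * Y k x) = 0.
Proof.
elim: n => [_|n IHn nk].
  under eq_Rintegral do rewrite /S big_ord0 mul0r.
  by rewrite /Rintegral integral0.
under eq_Rintegral do rewrite /S big_ord_recr/= mulrDl -mulrA.
rewrite RintegralD//.
- rewrite IHn ?(ltnW nk)// add0r RintegralZl//.
    by rewrite Rintegral_centered_indicM ?mulr0//; apply: indepA; rewrite ltn_eqF.
  apply: bounded_integrable.
    by apply: measurable_funM; exact: measurable_centered_indic.
  by exists (1 * 1) => x; rewrite normrM ler_pM// centered_indic_bounded.
- apply: bounded_integrable.
    by apply: measurable_funM; [exact: measurable_centered_sum|exact: measurable_centered_indic].
  exists ((\sum_(i < n) `|b i|) * 1) => x; rewrite normrM ler_pM//.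
    exact: centered_sum_bounded.
  exact: centered_indic_bounded.
- apply: bounded_integrable.
    apply: measurable_funM => //.
    by apply: measurable_funM; exact: measurable_centered_indic.
  by exists (`|b n| * (1 * 1)) => x; rewrite !normrM !ler_pM// ?mulr_ge0// ?centered_indic_bounded.
Qed.

(** Adding one term adds a cross term, which vanishes because the new indicator is uncorrelated with
    the preceding sum, and a square with factor at most 1. *)
Lemma centered_sum_sqr n : \int[P]_x (S n x ^+ 2) <= \sum_(i < n) b i ^+ 2.
Proof.
elim: n => [|n IHn].
  rewrite big_ord0; under eq_Rintegral do rewrite /S big_ord0 expr0n.
  by rewrite /Rintegral integral0.
have i1 : P.-integrable setT (EFin \o (fun x => S n x ^+ 2)).
  apply: bounded_integrable; first by apply: measurable_funX; exact: measurable_centered_sum.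
  exists ((\sum_(i < n) `|b i|) ^+ 2) => x; rewrite normrX lerXn2r ?nnegrE ?sumr_ge0//.
  exact: centered_sum_bounded.
have i2 : P.-integrable setT (EFin \o (fun x => S n x * Y n x)).
  apply: bounded_integrable.
    by apply: measurable_funM; [exact: measurable_centered_sum|exact: measurable_centered_indic].
  exists ((\sum_(i < n) `|b i|) * 1) => x; rewrite normrM ler_pM//.
    exact: centered_sum_bounded.
  exact: centered_indic_bounded.
have Y21 x : `|Y n x ^+ 2| <= 1 by rewrite normrX exprn_ile1// centered_indic_bounded.
have i3 : P.-integrable setT (EFin \o (fun x => Y n x ^+ 2)).
  apply: bounded_integrable; first by apply: measurable_funX; exact: measurable_centered_indic.
  by exists 1.
have i2' : P.-integrable setT (EFin \o (fun x => (2 * b n) * (S n x * Y n x))).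
  exact: (integrableZl measurableT (2 * b n) i2).
have i3' : P.-integrable setT (EFin \o (fun x => (b n) ^+ 2 * (Y n x ^+ 2))).
  exact: (integrableZl measurableT (b n ^+ 2) i3).
have i12 : P.-integrable setT (EFin \o (fun x => S n x ^+ 2 + (2 * b n) * (S n x * Y n x))).
  exact: (integrableD measurableT i1 i2').
rewrite (_ : \int[P]_x (S n.+1 x ^+ 2) = \int[P]_x ((S n x ^+ 2 + (2 * b n) * (S n x * Y n x)) +
    (b n) ^+ 2 * (Y n x ^+ 2))); last first.
  by apply: eq_Rintegral => x _; rewrite {1}/S big_ord_recr/= -/(S n x); ring.
rewrite (RintegralD measurableT i12 i3') (RintegralD measurableT i1 i2').
rewrite !RintegralZl// centered_sum_uncorrelated// mulr0 addr0 big_ord_recr/= lerD//.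
rewrite ler_piMr ?sqr_ge0//.
have -> : 1 = \int[P]_x (1 : R) by rewrite Rintegral_cst//= probability_setT mulr1.
apply: le_Rintegral => //.
  by apply: bounded_integrable => //; exists 1 => x; rewrite normr1.
by move=> x _; rewrite (le_trans (ler_norm _)).
Qed.

Lemma centered_sum_tail n (eps : R) : 0 < eps ->
  (P [set x | (eps < `|S n x|)%R] <= (eps ^- 2 * \sum_(i < n) b i ^+ 2)%:E)%E.
Proof.
move=> eps0; apply: le_trans (sqr_markov P eps0 (measurable_centered_sum n)) _.
have fS : (\int[P]_x (S n x ^+ 2)%:E)%E \is a fin_num.
  apply: integrable_fin_num => //; apply: bounded_integrable.
    by apply: measurable_funX; exact: measurable_centered_sum.
  exists ((\sum_(i < n) `|b i|) ^+ 2) => x; rewrite normrX lerXn2r ?nnegrE ?sumr_ge0//.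
  exact: centered_sum_bounded.
rewrite -(fineK fS) -EFinM lee_fin ler_wpM2l ?invr_ge0 ?exprn_ge0 ?(ltW eps0)//.
exact: centered_sum_sqr.
Qed.

End independent_sum.

(** * Weak law for the actual, not identically distributed data *)

Section alternative.
Context {R : realType} {m : nat}.
Context {dT : measure_display} {T : measurableType dT} (P : probability T R).
Variables (X : nat -> {RV P >-> m.-tuple R}) (F : 'cV[\bar R]_m -> R).
Hypothesis X_indep : mutually_independent P X.
Hypothesis F_cvg : {uniform, (fun i => dfun (distribution P (X i))) @ \oo --> F}.
Variables (a : nat -> nat -> R) (kappa : R).
Hypothesis a_ge0 : forall n i, (i < n)%N -> 0 <= a i n.
Hypothesis a_sum1 : forall n, (0 < n)%N -> \sum_(i < n) a i n = 1.
Hypothesis a_max : Num.sqrt n%:R * max_weight a n @[n --> \oo] --> (0 : R).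
Hypothesis a_sqr : n%:R * \sum_(i < n) a i n ^+ 2 @[n --> \oo] --> kappa.

Lemma measurable_sample n : measurable_fun setT (sample X n).
Proof.
apply/measurable_fun_tnthP => i.
rewrite (_ : _ \o _ = X i); first exact: measurable_funP.
by apply/funext => om /=; rewrite tnth_mktuple.
Qed.

(** A Toeplitz argument: the largest weight tends to 0, so the first N terms become negligible,
    while the others are within eps / 2 of the limit and carry total weight at most 1. *)
Lemma weighted_mean_cvg (p : nat -> R) (q : R) :
  p @ \oo --> q -> \sum_(i < n) a i n * p i @[n --> \oo] --> q.
Proof.
move=> pq; apply/cvgrPdist_le => eps eps0; have eps2 : 0 < eps / 2 by rewrite divr_gt0.
have [N _ NP] : \forall i \near \oo, `|q - p i| <= eps / 2 by move/cvgrPdist_le : pq; exact.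
pose C := \sum_(i < N) `|q - p i|.
have C0 : 0 <= C by exact: sumr_ge0.
have C1 : 0 < C + 1 by rewrite ltr_wpDl.
near=> n; have n0 : (0 < n)%N by near: n; exact: nbhs_infty_gt.
have aw i : (i < n)%N -> a i n <= Num.sqrt n%:R * max_weight a n.
  move=> iltn; apply: (@le_trans _ _ (max_weight a n)).
    exact: (@le_bigmax_cond _ _ _ 0 (Ordinal iltn) xpredT (fun i : 'I_n => a i n)).
  rewrite ler_peMl//; first exact: bigmax_ge_id.
  by rewrite -[leLHS]sqrtr1 ler_wsqrtr// ler1n.
(* The added 1 keeps the denominator positive when the first N deviations all vanish. *)
have small : Num.sqrt n%:R * max_weight a n <= eps / 2 / (C + 1).
  rewrite (le_trans (ler_norm _))// -normrN -[X in `|X|]add0r.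
  by near: n; move/cvgrPdist_le : a_max; apply; rewrite divr_gt0.
have Nn : (N <= n)%N by near: n; exact: nbhs_infty_ge.
rewrite -[q in leLHS]mul1r -(a_sum1 n0) mulr_suml -sumrB.
apply: le_trans (ler_norm_sum _ _ _) _.
apply: (@le_trans _ _ (\sum_(i < n)
    ((i < N)%:R * (eps / 2 / (C + 1) * `|q - p i|) + a i n * (eps / 2)))).
  apply: ler_sum => i _; rewrite -mulrBr normrM ger0_norm ?a_ge0//.
  have [iN|Ni] := ltnP i N.
    rewrite mul1r; apply: ler_wpDr; first by rewrite mulr_ge0 ?a_ge0 ?(ltW eps2).
    by apply: ler_wpM2r => //; rewrite (le_trans _ small)// aw.
  by rewrite mul0r add0r ler_wpM2l ?a_ge0//; exact: NP.
rewrite big_split/= -mulr_suml a_sum1// mul1r [leRHS]splitr lerD2r.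
have -> : \sum_(i < n) (i < N)%:R * (eps / 2 / (C + 1) * `|q - p i|) = eps / 2 / (C + 1) * C.
  rewrite mulr_sumr (big_ord_widen n (fun i => eps / 2 / (C + 1) * `|q - p i|) Nn).
  rewrite [RHS]big_mkcond/=.
  by apply: eq_bigr => i _; case: ltnP; rewrite ?mul1r ?mul0r.
by rewrite mulrAC -mulrA ler_piMr ?(ltW eps2)// ler_pdivrMr// mul1r lerDl.
Unshelve. all: end_near. Qed.

(** Half of [eps] is for the bias, the weighted mean of the individual distribution functions minus
    [F x], which is deterministic; the other half is for the centered sum. *)
Lemma alternative_wedf x (eps : R) : 0 < eps ->
  vanishing (fun n => P [set om | eps < `|wedf a (sample X n om) x - F x|]).
Proof.
move=> eps0; have eps2 : 0 < eps / 2 by rewrite divr_gt0.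
pose A i := X i @^-1` [set z | lev (emb z) x].
have mA i : measurable (A i).
  rewrite -[X in measurable X]setTI; apply: measurable_funP => //.
  exact: measurable_lev.
have indepA i j : i != j -> P (A i `&` A j) = (P (A i) * P (A j))%E.
  move=> ij; have := @X_indep [:: i; j] (fun=> [set z | lev (emb z) x]).
  rewrite /= inE ij => /(_ isT (fun=> measurable_lev x)).
  rewrite !big_cons big_nil mule1 => <-; congr (P _).
  apply/seteqP; split=> om /=.
    by move=> [Ai Aj] k; rewrite !inE => /orP[/eqP->|/eqP->].
  by move=> h; split; apply: h; rewrite !inE eqxx ?orbT.
have pF : (fun i => fine (P (A i))) @ \oo --> F x.
  apply/cvgrPdist_lt => e e0.
  have := uniform_cvg_le e0 F_cvg; apply: filterS => n /(_ x I).
  by [].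
have bF := weighted_mean_cvg pF.
apply: (@vanishing_le _ _ (EFin \o (fun n => (eps / 2) ^- 2 * \sum_(i < n) a i n ^+ 2))); last first.
  apply: vanishing_EFin; rewrite -[X in _ --> X](mulr0 ((eps / 2) ^- 2)).
  by apply: cvgM; [exact: cvg_cst|exact: sum_sqr_weights_cvg0 a_sqr].
near=> n.
have bFn : `|F x - \sum_(i < n) a i n * fine (P (A i))| <= eps / 2.
  by near: n; move/cvgrPdist_le : bF; exact.
apply: le_trans (centered_sum_tail (fun i => a i n) mA indepA n eps2).
have wE om : wedf a (sample X n om) x - \sum_(i < n) a i n * fine (P (A i)) =
    \sum_(i < n) a i n * (\1_(A i) om - fine (P (A i))).
  rewrite -sumrB; apply: eq_bigr => i _; rewrite -mulrBr; congr (_ * (_ - _)).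
  by rewrite tnth_mktuple lev_indic.
apply: le_measure; rewrite ?inE.
- apply: measurable_abs_gt; apply: measurable_funB => //.
  rewrite (_ : (fun om => _) = (fun z => wedf a z x) \o sample X n)//.
  by apply: measurableT_comp; [exact: measurable_wedf|exact: measurable_sample].
- apply: measurable_abs_gt. apply: (@measurable_centered_sum _ _ _ P A (fun i => a i n) mA n).
move=> om /=; rewrite -wE.
move: bFn; set q := \sum_(i < n) _ => bFn.
have := ler_normD (wedf a (sample X n om) x - q) (q - F x).
by rewrite addrA subrK (distrC q); lra.
Unshelve. all: end_near. Qed.

End alternative.

(** * Critical values and power *)

Section inner_probability.
Context {R : realType} {dT : measure_display} {T : measurableType dT} (P : probability T R).

Lemma inner_prob_le1 (A : set T) : (inner_prob P A <= 1)%E.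
Proof. by apply: ge_ereal_sup => _ [B [mB _] <-]; exact: probability_le1. Qed.

Lemma inner_prob_ge (A B : set T) : measurable B -> B `<=` A ->
  (P B <= inner_prob P A)%E.
Proof. by move=> mB BA; apply: ereal_sup_ubound; exists B. Qed.

Lemma inner_prob_ge_setC (A B : set T) (eta : R) : measurable B -> ~` B `<=` A ->
  (P B <= eta%:E)%E -> ((1 - eta)%:E <= inner_prob P A)%E.
Proof.
move=> mB BA PB; apply: le_trans (inner_prob_ge (measurableC mB) BA).
by rewrite probability_setC// EFinB leeB.
Qed.

Lemma inner_prob_cvg1 (E B : nat -> set T) :
  (\forall n \near \oo, measurable (B n) /\ ~` B n `<=` E n) ->
  vanishing (fun n => P (B n)) -> inner_prob P (E n) @[n --> \oo] --> 1%E.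
Proof.
move=> BE vB.
have bounds eta : 0 < eta ->
    \forall n \near \oo, ((1 - eta)%:E <= inner_prob P (E n))%E.
  move=> eta0; near=> n; have [mB sub] : measurable (B n) /\ ~` B n `<=` E n by near: n.
  by apply: (inner_prob_ge_setC mB sub); near: n; exact: vB.
have fin n : inner_prob P (E n) \is a fin_num.
  rewrite ge0_fin_numE; first exact: le_lt_trans (inner_prob_le1 _) (ltry _).
  by rewrite -(measure0 P); exact: inner_prob_ge.
apply/fine_cvgP; split; first exact: nearW.
apply/cvgrPdist_le => eta eta0; near=> n.
have : ((1 - eta)%:E <= inner_prob P (E n))%E by near: n; exact: bounds.
have := inner_prob_le1 (E n); rewrite -(fineK (fin n)) !lee_fin => ? ?.
by rewrite ger0_norm /=; lra.
Unshelve. all: end_near. Qed.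

(** Nonnegativity of [S] and [p > 0] make 0 a lower bound of the set in [quantile], so its [inf] is
    a genuine infimum and not a default value. *)
Lemma quantile_le (p y : R) (S : T -> R) : 0 < p -> (forall z, 0 <= S z) ->
  (p%:E <= inner_prob P [set z | (S z <= y)%R])%E -> quantile P p S <= y.
Proof.
move=> p0 S0 py; apply: ge_inf => //; exists 0 => r /= pr.
rewrite leNgt; apply/negP => r0.
have : (inner_prob P [set z | (S z <= r)%R] <= 0)%E.
  apply: ge_ereal_sup => _ [B [mB BS] <-].
  rewrite (_ : B = set0) ?measure0//; apply/seteqP; split=> // z /BS /=.
  by move=> /(le_trans (S0 z)); rewrite leNgt r0.
by move=> /(le_trans pr); rewrite lee_fin leNgt p0.
Qed.

End inner_probability.

(** * Deterministic bounds for the two statistics *)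

Section statistics_bounds.
Context {R : realType} {m d : nat}.
Variables (a : nat -> nat -> R) (n : nat).
Variables (K : 'cV[\bar R]_m -> 'cV[R]_d -> R) (tn : n.-tuple (m.-tuple R) -> 'cV[R]_d).
Hypothesis a_ge0 : forall i, (i < n)%N -> 0 <= a i n.
Hypothesis a_sum1 : \sum_(i < n) a i n = 1.
Implicit Types z : n.-tuple (m.-tuple R).

Lemma wedf_nondecreasing z x y : lev x y -> wedf a z x <= wedf a z y.
Proof.
move=> /forallP xy; apply: ler_sum => i _; rewrite ler_wpM2l ?a_ge0// ler_nat.
case zx : (lev _ x) => //; case zy : (lev _ y) => //.
move: zy => /negbT/negP[]; apply/forallP => k.
by move/forallP : zx => /(_ k)/le_trans; apply; exact: xy.
Qed.

Lemma wedf_ge0 z x : 0 <= wedf a z x.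
Proof. by apply: sumr_ge0 => i _; rewrite mulr_ge0 ?a_ge0. Qed.

Lemma wedf_le1 z x : wedf a z x <= 1.
Proof.
rewrite -[leRHS]a_sum1; apply: ler_sum => i _.
by rewrite ler_piMr ?a_ge0//; case: lev.
Qed.

Lemma KS_ge0 z : 0 <= KS a K tn z.
Proof.
rewrite mulr_ge0 ?sqrtr_ge0//.
set A := (X in sup X); rewrite -/A.
(* If the range is unbounded, [sup] takes its default value 0. *)
have [hA|nA] := pselect (has_sup A); last by rewrite sup_out.
have [_ [x _ _]] := hA.1; apply: (@le_trans _ _ `|wedf a z x - K x (tn z)|) => //.
by apply: ub_le_sup; [exact: hA.2|exists x].
Qed.

Lemma CvM_ge0 z : 0 <= CvM a K tn z.
Proof. by rewrite mulr_ge0//; apply: Rintegral_ge0 => y _; exact: sqr_ge0. Qed.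

Lemma KS_le z c : (forall x, `|wedf a z x - K x (tn z)| <= c) ->
  KS a K tn z <= Num.sqrt n%:R * c.
Proof.
move=> le_c; rewrite ler_wpM2l ?sqrtr_ge0//; apply: ge_sup.
  by exists `|wedf a z (\col_k 0%E) - K (\col_k 0%E) (tn z)|, (\col_k 0%E).
by move=> _ [x _ <-].
Qed.

Lemma KS_ge z x c : (forall x, `|wedf a z x - K x (tn z)| <= c) ->
  Num.sqrt n%:R * `|wedf a z x - K x (tn z)| <= KS a K tn z.
Proof.
move=> le_c; rewrite ler_wpM2l ?sqrtr_ge0//; apply: ub_le_sup.
  by exists c => _ [y _ <-].
by exists x.
Qed.

Lemma integral_sqr_le z c : (forall x, `|wedf a z x - K x (tn z)| <= c) ->
  (\int[dlaw (K ^~ (tn z))]_y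
     ((wedf a z (emb y) - K (emb y) (tn z)) ^+ 2)%:E <= (c ^+ 2)%:E)%E.
Proof.
move=> le_c; set mu := dlaw _.
rewrite -[leRHS](_ : (\int[mu]_y (cst (c ^+ 2)%:E y) = (c ^+ 2)%:E)%E); last first.
  by rewrite integral_cst//= probability_setT mule1.
apply: ge0_le_integralT => y; first by rewrite lee_fin sqr_ge0.
rewrite lee_fin -[leLHS]real_normK ?num_real// lerXn2r ?nnegrE//.
exact: le_trans (normr_ge0 _) (le_c (emb y)).
Qed.

Lemma integral_sqr_fin_num z c : (forall x, `|wedf a z x - K x (tn z)| <= c) ->
  (\int[dlaw (K ^~ (tn z))]_y
     ((wedf a z (emb y) - K (emb y) (tn z)) ^+ 2)%:E)%E \is a fin_num.
Proof.
move=> le_c; rewrite ge0_fin_numE; last by apply: integral_ge0 => y _; rewrite lee_fin sqr_ge0.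
exact: le_lt_trans (integral_sqr_le le_c) (ltry _).
Qed.

Lemma CvM_le z c : (forall x, `|wedf a z x - K x (tn z)| <= c) ->
  CvM a K tn z <= n%:R * c ^+ 2.
Proof.
move=> le_c; rewrite ler_wpM2l// -lee_fin fineK ?(integral_sqr_fin_num le_c)//.
exact: integral_sqr_le.
Qed.

(** Restriction of the integral to [Q]. The bound [c] ensures that the integral is finite, since
    [fine] would send an infinite value to 0. *)
Lemma CvM_ge z c e (Q : set (m.-tuple R)) : measurable Q -> 0 <= e ->
  (forall x, `|wedf a z x - K x (tn z)| <= c) ->
  (forall y, Q y -> e <= `|wedf a z (emb y) - K (emb y) (tn z)|) ->
  n%:R * (e ^+ 2 * fine (dlaw (K ^~ (tn z)) Q)) <= CvM a K tn z.
Proof.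
move=> mQ e0 le_c ge_e; set mu := dlaw _.
rewrite ler_wpM2l// -lee_fin fineK ?(integral_sqr_fin_num le_c)//.
rewrite EFinM fineK ?fin_num_measure// -[X in mu X]setIT -integral_indic//.
rewrite -ge0_integralZl//; last 2 first.
- by apply/measurable_EFinP; exact: measurable_indic.
- by rewrite lee_fin sqr_ge0.
apply: ge0_le_integralT => y; first by rewrite -EFinM lee_fin mulr_ge0 ?sqr_ge0.
rewrite -EFinM lee_fin indicE.
have [/set_mem Qy|_] := boolP (y \in Q); last by rewrite mulr0 sqr_ge0.
by rewrite mulr1 -[leRHS]real_normK ?num_real// lerXn2r ?nnegrE ?ge_e.
Qed.

End statistics_bounds.

(** * Consistency of the tests *)

Section power.
Context {R : realType} {m d : nat}.
Variables (Theta : set 'cV[R]_d).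
Context {dT : measure_display} {T : measurableType dT} (P : probability T R).
Variables (X : nat -> {RV P >-> m.-tuple R}) (X_indep : mutually_independent P X).
Variables (F : 'cV[\bar R]_m -> R) (F_uc : unif_continuous F).
Hypothesis F_cvg : {uniform, (fun i => dfun (distribution P (X i))) @ \oo --> F}.
Variables (Gn : nat -> 'cV[\bar R]_m -> 'cV[R]_d -> R).
Variables (G : 'cV[\bar R]_m -> R) (G_df : is_dfun G) (G_uc : unif_continuous G).
Hypothesis Gn_df : forall n u, (0 < n)%N -> Theta u -> is_dfun (Gn n ^~ u).
Variables (theta : 'cV[R]_d) (theta_Theta : Theta theta).
Hypothesis Gn_cvg : {uniform, (fun n => Gn n ^~ theta) @ \oo --> G}.
Variables (a : nat -> nat -> R) (kappa : R).
Hypothesis a_ge0 : forall n i, (i < n)%N -> 0 <= a i n.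
Hypothesis a_sum1 : forall n, (0 < n)%N -> \sum_(i < n) a i n = 1.
Hypothesis a_max : Num.sqrt n%:R * max_weight a n @[n --> \oo] --> (0 : R).
Hypothesis a_sqr : n%:R * \sum_(i < n) a i n ^+ 2 @[n --> \oo] --> kappa.
Variable t : forall n, n.-tuple (m.-tuple R) -> 'cV[R]_d.
Arguments t : clear implicits.
Hypothesis t_Theta : forall n z, (0 < n)%N -> Theta (t n z).
Hypothesis t_meas : forall n, (0 < n)%N ->
  measurable_fun setT (t n : _ -> g_sigma_algebraType (@open 'cV[R]_d)).
Variables (alpha : R) (alpha_gt0 : 0 < alpha) (alpha_lt1 : alpha < 1).
Hypothesis t_cvg : forall eps : R, 0 < eps ->
  P [set om | eps < `|t n (sample X n om) - theta|] @[n --> \oo] --> 0%E.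
Variables (U : set 'cV[R]_d) (hC1 : C1 Theta U theta Gn).
Variables (g : 'cV[\bar R]_m -> 'cV[R]_d -> 'cV[R]_d) (hC2 : C2 U theta Gn g).
Variables (v : 'M[R]_d) (w : 'cV[\bar R]_m -> 'cV[R]_d).
Hypothesis hC56 : forall un : nat -> 'cV[R]_d,
  (forall n, Theta (un n)) -> un @ \oo --> theta ->
  exists l : nat -> m.-tuple R -> 'cV[R]_d -> 'cV[R]_d,
    C5 a U Gn t un l /\ C6 a Gn un l v w.

Let model_bound n z x : (0 < n)%N -> `|wedf a z x - Gn n x (t n z)| <= 1.
Proof.
move=> n0.
have K_df : is_dfun (Gn n ^~ (t n z)) by apply: Gn_df => //; exact: t_Theta.
have -> : Gn n x (t n z) = dfun (dlaw (Gn n ^~ (t n z))) x by rewrite dlawK.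
have := dfun_ge0 (dlaw (Gn n ^~ (t n z))) x.
have := dfun_le1 (dlaw (Gn n ^~ (t n z))) x.
have := wedf_ge0 (a_ge0 (n := n)) z x; have := wedf_le1 (a_ge0 (n := n)) (a_sum1 n0) z x.
by rewrite ler_norml => *; apply/andP; split; lra.
Qed.

Let measurable_estimator_tail n (eps : R) : (0 < n)%N -> 0 < eps ->
  measurable [set z | eps < `|t n z - theta|].
Proof.
move=> n0 eps0; apply: measurable_norm_gt; first exact: ltW.
move=> k; under eq_fun do rewrite !mxE.
by apply: measurable_funB => //; apply: measurable_coord; exact: t_meas.
Qed.

(** The bad event. It is used with [K] the n-th model under the null law, and with [K] equal to [F]
    for the actual data. *)
Definition deviation_set n (J : finType) (pt : J -> 'cV[\bar R]_m) (delta c : R)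
    (K : 'cV[\bar R]_m -> R) : set (n.-tuple (m.-tuple R)) :=
  [set z | delta < `|t n z - theta|] `|`
  [set z | exists j, c < `|wedf a z (pt j) - K (pt j)|].

Arguments deviation_set n {J}.

Lemma measurable_deviation_set (J : finType) (pt : J -> 'cV[\bar R]_m) (delta c : R)
    (K : 'cV[\bar R]_m -> R) n : (0 < n)%N -> 0 < delta ->
  measurable (deviation_set n pt delta c K).
Proof.
move=> n0 d0; apply: measurableU; first exact: measurable_estimator_tail.
apply: measurable_fin_union => j.
by apply: measurable_abs_gt; apply: measurable_funB => //; exact: measurable_wedf.
Qed.

Lemma deviation_set_le {dS} {S : measurableType dS} (mu : probability S R) n
    (h : S -> n.-tuple (m.-tuple R)) (J : finType) (pt : J -> 'cV[\bar R]_m)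
    (delta c : R) (K : 'cV[\bar R]_m -> R) : (0 < n)%N -> 0 < delta ->
  measurable_fun setT h ->
  (mu (h @^-1` deviation_set n pt delta c K) <=
   mu [set s | (delta < `|t n (h s) - theta|)%R] +
   \sum_j mu [set s | (c < `|wedf a (h s) (pt j) - K (pt j)|)%R])%E.
Proof.
move=> n0 d0 mh.
have mA : measurable [set s | delta < `|t n (h s) - theta|].
  rewrite -[X in measurable X]setTI.
  by apply: (mh measurableT [set z | delta < `|t n z - theta|]); exact: measurable_estimator_tail.
have mB j : measurable [set s | c < `|wedf a (h s) (pt j) - K (pt j)|].
  apply: measurable_abs_gt; apply: measurable_funB => //.
  rewrite (_ : (fun s => _) = (fun z => wedf a z (pt j)) \o h)//.
  by apply: measurableT_comp => //; exact: measurable_wedf.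
have mBU := measurable_fin_union mB; have BUle := measure_fin_union_le mu mB.
rewrite /deviation_set preimage_setU.
by apply: le_trans (measureU2 _ _ _) _ => //; rewrite leeD2l.
Qed.

(** * A common treatment of KS and CvM through a scale [s] *)

Section statistic.
Variables (S : forall n, n.-tuple (m.-tuple R) -> R) (s : nat -> R).
Arguments S : clear implicits.
Hypothesis S_ge0 : forall n z, 0 <= S n z.
Hypothesis S_small : forall eps : R, 0 < eps -> exists2 c : R, 0 < c & forall n z,
  (0 < n)%N -> (forall x, `|wedf a z x - Gn n x (t n z)| <= c) -> S n z <= s n * eps.

(** Off the bad event, at a grid point the weighted empirical distribution function is within c/8 of
    the model at [u] and thus within c/4 of G. Interpolation gives c/2 everywhere, and passing from
    G to the model at the estimator adds c/8, for a total below [c]. *)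
Lemma critical_value_small (eps : R) : 0 < eps ->
  exists2 delta : R, 0 < delta & \forall n \near \oo, forall u, Theta u ->
    `|u - theta| < delta -> critical_value (Gn n) alpha (S n) u <= s n * eps.
Proof.
move=> eps0; have [c c0 Sc] := S_small eps0.
have c8 : 0 < c / 8 by rewrite divr_gt0.
have c4 : 0 < c / 4 by rewrite divr_gt0.
have [delta delta0 close] := model_close hC1 hC2 Gn_cvg c8.
have delta2 : 0 < delta / 2 by rewrite divr_gt0.
(* The grid is built for the limit G, so it serves all n and all parameters at once. *)
have [I [lo [up [cover osc]]]] := grid_exists (unif_continuous_contract G_uc) c8.
pose pt (j : bool * I) := if j.1 then lo j.2 else up j.2.
pose Bad n (u : 'cV[R]_d) := deviation_set n pt (delta / 2) (c / 8) (Gn n ^~ u).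
have [r r0 rP] : exists2 r : R, 0 < r & \forall n \near \oo, forall u, Theta u ->
    `|u - theta| < r -> (iid_law (dlaw (Gn n ^~ u)) n (Bad n u) <= alpha%:E)%E.
  apply: sequential_uniform => // un unT uncvg.
  have [l [h5 h6]] := hC56 unT uncvg.
  have [oU _ _ Uth _] := hC1.
  have vA := null_estimator a_sqr t_meas oU Uth uncvg h5 h6 delta2.
  have vB := vanishing_sum (index_enum (bool * I)%type) (fun j =>
    null_wedf a_sum1 a_sqr Gn_df unT (pt j) c8).
  have := vanishingD vA vB alpha_gt0; apply: filter_app; near=> n.
  apply: le_trans; apply: (@deviation_set_le _ _ (iid_law (dlaw (Gn n ^~ (un n))) n) n id) => //.
  by near: n; exact: nbhs_infty_gt.
exists (Num.min r delta); first by rewrite lt_min r0.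
near=> n => u Tu; rewrite lt_min => /andP[ur ud].
have n0 : (0 < n)%N by near: n; exact: nbhs_infty_gt.
have closen u' : `|u' - theta| < delta -> forall x, `|Gn n x u' - G x| <= c / 8.
  move=> u'd; suff : U u' /\ forall x, `|Gn n x u' - G x| <= c / 8 by case.
  by move: u' u'd; near: n.
have Badu : (iid_law (dlaw (Gn n ^~ u)) n (Bad n u) <= alpha%:E)%E.
  by move: u Tu ur {ud}; near: n.
apply: quantile_le => //; first by rewrite subr_gt0.
apply: inner_prob_ge_setC Badu; first exact: measurable_deviation_set.
move=> z /= /not_orP[/negP tz nbad]; apply: Sc => // x.
rewrite -leNgt in tz.
have tzd : `|t n z - theta| < delta by apply: le_lt_trans tz _; lra.
have gridG j : `|wedf a z (pt j) - G (pt j)| <= c / 4.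
  have h1 : `|wedf a z (pt j) - Gn n (pt j) u| <= c / 8.
    by rewrite leNgt; apply/negP => bad; apply: nbad; exists j.
  have h2 := closen u ud (pt j).
  have := ler_normD (wedf a z (pt j) - Gn n (pt j) u) (Gn n (pt j) u - G (pt j)).
  by rewrite addrA subrK; lra.
have allG : `|wedf a z x - G x| <= c / 4 + c / 4.
  apply: (@grid_close _ _ I lo up G (wedf a z)).
  - by move=> x1 x2; apply: wedf_nondecreasing => i; exact: a_ge0.
  - by move=> x1; have [i [? ? _]] := cover x1; exists i.
  - by move=> i x1 x2 l1 l2 l3 l4; apply: le_trans (osc i x1 x2 l1 l2 l3 l4) _; lra.
  - by move=> i; split; [exact: (gridG (true, i))|exact: (gridG (false, i))].
have := closen _ tzd x; rewrite distrC => h3.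
have := ler_normD (wedf a z x - G x) (G x - Gn n x (t n z)).
by rewrite addrA subrK; lra.
Unshelve. all: end_near. Qed.

(** The level [s n * eta] separates the two sides: the critical value lies below it by
    [critical_value_small] with the same [eta], the statistic above it off the bad event. *)
Lemma power_cvg1 (J : finType) (pt : J -> 'cV[\bar R]_m) (delta c eta : R) :
  0 < delta -> 0 < c -> 0 < eta ->
  (\forall n \near \oo, forall z : n.-tuple (m.-tuple R),
    `|t n z - theta| <= delta -> (forall j, `|wedf a z (pt j) - F (pt j)| <= c) ->
    s n * eta <= S n z) ->
  inner_prob P [set om | critical_value (Gn n) alpha (S n) (t n (sample X n om))
    <= S n (sample X n om)] @[n --> \oo] --> 1%E.
Proof.
move=> delta0 c0 eta0 Sge; have [r r0 crit] := critical_value_small eta0.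
(* Halving r turns the weak inequality on the complement of the bad event into the strict one
   required for the critical value. *)
pose rho := Num.min delta (r / 2).
have rho0 : 0 < rho by rewrite lt_min delta0 divr_gt0.
apply: (@inner_prob_cvg1 _ _ _ _ _ (fun n => sample X n @^-1` deviation_set n pt rho c F)).
  near=> n; have n0 : (0 < n)%N by near: n; exact: nbhs_infty_gt.
  split.
    rewrite -[X in measurable X]setTI; apply: measurable_sample => //.
    exact: measurable_deviation_set.
  move=> om /= /not_orP[/negP tz nbad].
  rewrite -leNgt le_min in tz; move/andP: tz => [tzd tzr].
  apply: (@le_trans _ _ (s n * eta)).
    have /(_ _ (t_Theta _ n0)) : forall u, Theta u -> `|u - theta| < r ->
      critical_value (Gn n) alpha (S n) u <= s n * eta by near: n.
    by apply; apply: le_lt_trans tzr _; lra.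
  have : forall z : n.-tuple (m.-tuple R), `|t n z - theta| <= delta ->
    (forall j, `|wedf a z (pt j) - F (pt j)| <= c) -> s n * eta <= S n z by near: n.
  apply => // j; rewrite leNgt; apply/negP => bad; apply: nbad.
  by exists j.
have vA := cvg_vanishing (t_cvg rho0).
have vB := vanishing_sum (index_enum J) (fun j =>
  alternative_wedf X_indep F_cvg a_ge0 a_sum1 a_max a_sqr (pt j) c0).
apply: vanishing_le (vanishingD vA vB); near=> n.
apply: deviation_set_le => //; last exact: measurable_sample.
by near: n; exact: nbhs_infty_gt.
Unshelve. all: end_near. Qed.

End statistic.

Lemma KS_power : ~ (forall x, F x - G x = 0) ->
  inner_prob P [set om |
    critical_value (Gn n) alpha (KS a (Gn n) (t n)) (t n (sample X n om)) <=
    KS a (Gn n) (t n) (sample X n om)] @[n --> \oo] --> 1%E.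
Proof.
move=> /existsNP[x0 /eqP FG]; set D := `|F x0 - G x0|.
have D0 : 0 < D by rewrite normr_gt0.
have D4 : 0 < D / 4 by rewrite divr_gt0.
have [delta delta0 close] := model_close hC1 hC2 Gn_cvg D4.
(* Of the gap D at [x0], sampling and model error cost at most D/4 each, which leaves D/2. *)
apply: (@power_cvg1 (fun n => KS a (Gn n) (t n)) (fun n => Num.sqrt n%:R) _ _
  unit (fun=> x0) (delta / 2) (D / 4) (D / 2)); rewrite ?divr_gt0//.
- by move=> n z; exact: KS_ge0.
- by move=> eps eps0; exists eps => // n z n0; exact: KS_le.
near=> n => z tz /(_ tt) wF.
have n0 : (0 < n)%N by near: n; exact: nbhs_infty_gt.
have tzd : `|t n z - theta| < delta by apply: le_lt_trans tz _; lra.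
have GG : `|Gn n x0 (t n z) - G x0| <= D / 4.
  suff : U (t n z) /\ forall x, `|Gn n x (t n z) - G x| <= D / 4 by case.
  by move: z {wF tz} tzd; near: n; apply: filterS close => n h z; exact: h.
apply: le_trans (KS_ge x0 (fun x => model_bound z x n0)).
rewrite ler_wpM2l ?sqrtr_ge0//.
move: wF GG; rewrite /D; set f := F _; set h := wedf _ _ _; set k := Gn _ _ _.
set q := G _ => h1 h2.
have := ler_normD (f - h) (h - k + (k - q)); have := ler_normD (h - k) (k - q).
have -> : f - h + (h - k + (k - q)) = f - q by ring.
by rewrite (distrC f h); lra.
Unshelve. all: end_near. Qed.

Lemma CvM_power : ~ {ae dlaw G, forall y, F (emb y) - G (emb y) = 0} ->
  inner_prob P [set om |
    critical_value (Gn n) alpha (CvM a (Gn n) (t n)) (t n (sample X n om)) <=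
    CvM a (Gn n) (t n) (sample X n om)] @[n --> \oo] --> 1%E.
Proof.
have ucF := unif_continuous_contract F_uc.
move=> /(positive_cell (contract_ucontB ucF (unif_continuous_contract G_uc))).
move=> [eta [xlo [xup [eta0 Q0 Qeta]]]].
set Q := cell xlo xup in Q0 Qeta; have mQ : measurable Q by exact: measurable_cell.
pose p := fine (dlaw G Q).
have p0 : 0 < p by rewrite -lte_fin fineK ?fin_num_measure.
pose M : R := 2 ^+ m.
have M0 : 0 < M by rewrite exprn_gt0.
(* With c at most eta/8, the deviations 2c from F and c from G leave a gap above eta/2 on [Q]. With
   2^m c at most p/2, the fitted law gives [Q] mass at least p/2. *)
pose c := Num.min (eta / 8) (p / 2 / M).
have c0 : 0 < c by rewrite lt_min !divr_gt0.
have ceta : c <= eta / 8 by rewrite ge_min lexx.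
have cp : M * c <= p / 2 by rewrite mulrC -ler_pdivlMr// ge_min lexx orbT.
have [delta delta0 close] := model_close hC1 hC2 Gn_cvg c0.
have [I [lo [up [cover osc]]]] := grid_exists ucF c0.
pose pt (j : bool * I) := if j.1 then lo j.2 else up j.2.
apply: (@power_cvg1 (fun n => CvM a (Gn n) (t n)) (fun n => n%:R) _ _
  _ pt (delta / 2) c ((eta / 2) ^+ 2 * (p / 2))); rewrite ?mulr_gt0 ?exprn_gt0 ?divr_gt0//.
- by move=> n z; exact: CvM_ge0.
(* CvM is at most n c^2, and c = min(1, eps) gives c^2 at most eps. *)
- move=> eps eps0; exists (Num.min 1 eps) => [|n z n0 le_c]; first by rewrite lt_min ltr01.
  apply: le_trans (CvM_le le_c) _; rewrite ler_wpM2l// expr2.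
  apply: (@le_trans _ _ (1 * eps)); last by rewrite mul1r.
  have min0 : 0 <= Num.min 1 eps by rewrite le_min ler01 ltW.
  by apply: ler_pM => //; rewrite ge_min lexx ?orbT.
near=> n => z tz wF.
have n0 : (0 < n)%N by near: n; exact: nbhs_infty_gt.
have tzd : `|t n z - theta| < delta by apply: le_lt_trans tz _; lra.
have GG x : `|Gn n x (t n z) - G x| <= c.
  suff : U (t n z) /\ forall x, `|Gn n x (t n z) - G x| <= c by case.
  by move: z {wF tz} tzd; near: n; apply: filterS close => n h z; exact: h.
have K_df : is_dfun (Gn n ^~ (t n z)) by apply: Gn_df => //; exact: t_Theta.
have QG : `|fine (dlaw (Gn n ^~ (t n z)) Q) - p| <= M * c.
  by apply: cell_close => x; rewrite !dlawK.
have allF x : `|wedf a z x - F x| <= c + c.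
  apply: (@grid_close _ _ I lo up F (wedf a z)) => //.
  - by move=> x1 x2; apply: wedf_nondecreasing => i; exact: a_ge0.
  - by move=> x1; have [i [? ? _]] := cover x1; exists i.
  - by move=> i; split; [exact: (wF (true, i))|exact: (wF (false, i))].
have eta2 : 0 <= eta / 2 by rewrite ltW// divr_gt0.
apply: (le_trans _ (CvM_ge mQ eta2 (fun x => model_bound z x n0) _)).
  rewrite ler_wpM2l// ler_wpM2l ?sqr_ge0//.
  by move: QG; rewrite ler_norml => /andP[? ?]; lra.
move=> y Qy; have := Qeta y Qy; have := allF (emb y); have := GG (emb y).
set f := F _; set h := wedf _ _ _; set k := Gn _ _ _; set q := G _ => h1 h2 h3.
have := ler_normD (f - h) (h - k + (k - q)); have := ler_normD (h - k) (k - q).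
have -> : f - h + (h - k + (k - q)) = f - q by ring.
by rewrite (distrC f h); lra.
Unshelve. all: end_near. Qed.

End power.

Theorem corollary8
  (R : realType) (m d : nat) (m_gt0 : (0 < m)%N) (d_gt0 : (0 < d)%N)
  (Theta : set 'cV[R]_d) (Theta_neq0 : Theta !=set0)
  (* observations *)
  (dT : measure_display) (T : measurableType dT) (P : probability T R)
  (X : nat -> {RV P >-> m.-tuple R})
  (X_indep : mutually_independent P X)
  (F : 'cV[\bar R]_m -> R)
  (F_df : is_dfun F) (F_uc : unif_continuous F)
  (F_cvg : {uniform, (fun i => dfun (distribution P (X i))) @ \oo --> F})
  (* model *)
  (Gn : nat -> 'cV[\bar R]_m -> 'cV[R]_d -> R)
  (G : 'cV[\bar R]_m -> 'cV[R]_d -> R)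
  (Gn_df : forall n u, (0 < n)%N -> Theta u -> is_dfun (Gn n ^~ u))
  (G_df : forall u, Theta u -> is_dfun (G ^~ u))
  (G_uc : forall u, Theta u -> unif_continuous (G ^~ u))
  (Gn_cvg : forall u, Theta u ->
    {uniform, (fun n => Gn n ^~ u) @ \oo --> G ^~ u})
  (* weights *)
  (a : nat -> nat -> R) (kappa : R)
  (a_ge0 : forall n i, (i < n)%N -> 0 <= a i n)
  (a_sum1 : forall n, (0 < n)%N -> \sum_(i < n) a i n = 1)
  (a_max : Num.sqrt n%:R * max_weight a n @[n --> \oo] --> (0 : R))
  (kappa_ge1 : 1 <= kappa)
  (a_sqr : n%:R * \sum_(i < n) a i n ^+ 2 @[n --> \oo] --> kappa)
  (* estimators *)
  (t : forall n, n.-tuple (m.-tuple R) -> 'cV[R]_d)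
  (t_Theta : forall n z, (0 < n)%N -> Theta (t n z))
  (t_meas : forall n, (0 < n)%N ->
    measurable_fun setT (t n : _ -> g_sigma_algebraType (@open 'cV[R]_d)))
  (* level, limit of the estimator, and conditions C1, C2, C5, C6 *)
  (alpha : R) (alpha_gt0 : 0 < alpha) (alpha_lt1 : alpha < 1)
  (theta : 'cV[R]_d) (theta_Theta : Theta theta)
  (t_cvg : forall eps : R, 0 < eps ->
    P [set om | eps < `|t n (sample X n om) - theta|] @[n --> \oo] --> 0%E)
  (U : set 'cV[R]_d) (hC1 : C1 Theta U theta Gn)
  (g : 'cV[\bar R]_m -> 'cV[R]_d -> 'cV[R]_d) (hC2 : C2 U theta Gn g)
  (v : 'M[R]_d) (w : 'cV[\bar R]_m -> 'cV[R]_d)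
  (hC56 : forall un : nat -> 'cV[R]_d,
    (forall n, Theta (un n)) -> un @ \oo --> theta ->
    exists l : nat -> m.-tuple R -> 'cV[R]_d -> 'cV[R]_d,
      C5 a U Gn t un l /\ C6 a Gn un l v w) :
  let cc x := cov_limit kappa (G ^~ theta) (g ^~ theta) w v x x in
  let ks n := KS a (Gn n) (t n) in
  let cvm n := CvM a (Gn n) (t n) in
  let c n := critical_value (Gn n) alpha (ks n) in
  let d_ n := critical_value (Gn n) alpha (cvm n) in
  let mu := dlaw (G ^~ theta) in
  (~ (forall x, F x - G x theta = 0) -> ~ (forall x, cc x = 0) ->
    inner_prob P [set om |
        c n (t n (sample X n om)) <= ks n (sample X n om)]
      @[n --> \oo] --> 1%E) /\
  (~ {ae mu, forall y, F (emb y) - G (emb y) theta = 0} ->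
   ~ {ae mu, forall y, cc (emb y) = 0} ->
    inner_prob P [set om |
        d_ n (t n (sample X n om)) <= cvm n (sample X n om)]
      @[n --> \oo] --> 1%E).

Proof.
move=> cc ks cvm c d_ mu; split=> [FG _|FG _].
  exact: (KS_power X_indep F_cvg (G_uc _ theta_Theta) Gn_df theta_Theta (Gn_cvg _ theta_Theta)
    a_ge0 a_sum1 a_max a_sqr t_Theta t_meas alpha_gt0 alpha_lt1 t_cvg hC1 hC2 hC56 FG).
exact: (CvM_power X_indep F_uc F_cvg (G_df _ theta_Theta) (G_uc _ theta_Theta) Gn_df theta_Theta
  (Gn_cvg _ theta_Theta) a_ge0 a_sum1 a_max a_sqr t_Theta t_meas alpha_gt0 alpha_lt1 t_cvg hC1 hC2
  hC56 FG).
Qed.
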